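(* Let $r$ and $s$ be multiplicatively independent positive integers (that is, $\log r/\log s$ is irrational), and let $X, Y \subseteq [0,1]$ be $\times r$- and $\times s$-invariant sets, respectively. Define $\overline{\gamma} = \min\big(\dim_{\mathrm{H}} X + \dim_{\mathrm{H}} Y, 1\big)$. Then for every compact set $I \subseteq \mathbb{R}\setminus\{0\}$ and every $\gamma < \overline{\gamma}$, \[ \inf_{\lambda,\eta \in I} \mathcal{H}^{\gamma}_{\infty}\big(\lambda X + \eta Y\big) > 0. \]
   Context: For $r \in \mathbb{N}$, $T_r\colon[0,1]\to[0,1]$ is the map $T_r x = \{rx\}$ (fractional part), and a set $X \subseteq [0,1]$ is called $\times r$-invariant if it is closed and $T_r X \subseteq X$. $\dim_{\mathrm{H}}$ denotes Hausdorff dimension. For $X \subseteq \mathbb{R}^d$ and $\gamma>0$, the unlimited $\gamma$-Hausdorff content is $\mathcal{H}^\gamma_\infty(X) = \inf\{\sum_{i} \delta_i^\gamma : X \subseteq \bigcup_i B_i,\ B_i \text{ an open ball of diameter } \delta_i\}$. Also $\lambda X + \eta Y = \{\lambda x + \eta y : x \in X, y \in Y\}$. *)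

(* Defs.v *)
From HB Require Import structures.
From mathcomp Require Import all_boot all_order all_algebra.
From mathcomp Require Import all_classical all_reals all_analysis.

Set Implicit Arguments.
Unset Strict Implicit.
Unset Printing Implicit Defensive.

Import Order.TTheory GRing.Theory Num.Theory.
Import numFieldNormedType.Exports.

Local Open Scope classical_set_scope.
Local Open Scope ring_scope.

(* [ln 1 = 0] and division by [0] gives [0], so this fails when [r] or [s]
   is at most [1]. *)
Definition mult_independent (R : realType) (r s : nat) : Prop :=
  irrational (ln r%:R / ln s%:R : R).

Definition times_map (R : realType) (r : nat) (x : R) : R :=
  r%:R * x - (Num.floor (r%:R * x))%:~R.

Definition times_invariant (R : realType) (r : nat) (X : set R) : Prop :=
  [/\ X `<=` `[0, 1], closed X & times_map r @` X `<=` X].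

(* Covers are indexed by a set [D] of natural numbers, so that both finite and
   countably infinite covers are allowed. *)

(* A ball of diameter [delta i] has radius [delta i / 2]. *)
Definition hausdorff_content (R : realType) (gamma : R) (X : set R) : \bar R :=
  ereal_inf [set z | exists (D : set nat) (c delta : nat -> R),
    [/\ forall i, D i -> 0 < delta i,
        X `<=` \bigcup_(i in D) ball (c i) (delta i / 2)
      & z = (\esum_(i in D) (delta i `^ gamma)%:E)%E]].

(* The maximum with [0] only serves to give the empty set diameter [0]. *)
Definition diameter (R : realType) (U : set R) : \bar R :=
  maxe 0%E (ereal_sup [set (`|x - y|)%:E | x in U & y in U]).

Definition hausdorff_premeasure (R : realType) (s delta : R) (X : set R) :
    \bar R :=
  ereal_inf [set z | exists (D : set nat) (U : nat -> set R),
    [/\ forall i, D i -> (diameter (U i) <= delta%:E)%E,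
        X `<=` \bigcup_(i in D) U i
      & z = (\esum_(i in D) (diameter (U i) `^ s))%E]].

(* The limit as [delta] tends to [0] from above is a supremum by monotonicity. *)
Definition hausdorff_measure (R : realType) (s : R) (X : set R) : \bar R :=
  ereal_sup [set hausdorff_premeasure s delta X | delta in [set d : R | 0 < d]].

(* With this convention the empty set has dimension [0]. *)
Definition hausdorff_dim (R : realType) (X : set R) : \bar R :=
  ereal_inf [set s%:E | s in
    [set s : R | 0 <= s /\ hausdorff_measure s X = 0%E]].

Definition scaled_sumset (R : realType) (lambda eta : R) (X Y : set R) : set R :=
  [set lambda * x + eta * y | x in X & y in Y].

(* Main.v *)
(* Fix a large scale Q = r^N. Zooming by Q in X and by a power of s close to Q
   in Y turns the sum X + tY into a union of rescaled sums Z + t'V, where Z and V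
   are rescaled pieces of X and Y, again subsets of X and Y, and t -> t' is an
   irrational rotation in the variable log t / log s. By invariance, X has at
   most about Q^alpha cells at scale 1/Q, with alpha a critical exponent at least
   dim X, and likewise for Y with beta. Hence a piece of large content either
   splits into about Q^alpha pieces of comparable content, or contains a piece of
   much larger normalized content; as contents are at most 1, the second case is
   rare along any branch. The energy of the projections of the product of the two
   digit sets, averaged along the orbit of t, is that of a set of dimension
   min(alpha + beta, 1), so most slopes of the orbit are good for all large
   subsets of the product. At a good slope the pieces project to about
   Q^min(alpha + beta, 1) essentially disjoint intervals, one of which sees a
   cover of volume smaller by that factor; iterating, a ball cover of too small
   volume would miss a point of X + tY. *)
Require Import Defs.
From mathcomp Require Import all_boot all_order all_algebra.
From mathcomp Require Import all_classical all_reals all_analysis.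
From mathcomp Require Import ring lra zify.
Import Order.TTheory GRing.Theory Num.Theory.
Import numFieldNormedType.Exports.
Set Implicit Arguments.
Unset Strict Implicit.
Unset Printing Implicit Defensive.
Local Open Scope classical_set_scope.
Local Open Scope ring_scope.

(** * Elementary counting in finite lists *)

Lemma size_le_diam (R : realType) (s : seq nat) (D : R) : uniq s -> 0 <= D ->
  (forall i j, i \in s -> j \in s -> i%:R - j%:R <= D) -> (size s)%:R <= D + 1.
Proof.
move=> us D0 hs; case: s us hs => [|a s'] us hs; first by rewrite addr_ge0.
set s := a :: s' in us hs *.
have ex : exists n, n \in s by exists a; rewrite mem_head.
case: (ex_minnP ex) => m ms mmin.


have sub : {subset s <= iota m (Num.truncn D).+1}.
  move=> i si; rewrite mem_iota mmin //= addnS ltnS -leq_subLR.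
  rewrite truncn_ge_nat// natrB ?mmin//; exact: hs.
have := uniq_leq_size us sub; rewrite size_iota -(ler_nat R) => /le_trans; apply.
by rewrite -natr1 lerD2r truncn_le.
Qed.

Lemma size_le_cover (T : eqType) (K : Type) (s : seq T) (ks : seq K)
    (P : K -> pred T) :
  {in s, forall x, has (P^~ x) ks} -> (size s <= \sum_(k <- ks) count (P k) s)%N.
Proof.
elim: s => [//|x s IH] h /=.
rewrite big_split /= -add1n leq_add//; last first.
  by apply: IH => y ys; apply: h; rewrite inE ys orbT.
move: (h x (mem_head x s)); elim: ks {h IH} => [//|k ks IHk] /= /orP[pk|hk]; rewrite big_cons.
  by rewrite pk leq_addr.
by rewrite (leq_trans (IHk hk)) // leq_addl.
Qed.

(** * Equidistribution of irrational rotations *)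

(** Pigeonhole on the fractional parts of [n * theta] for n from 0 to K, sorted into K bins of width
    1/K < d. Irrationality makes the difference nonzero, so that it can serve as the step of a
    progression. *)
Lemma dirichlet_approx (R : realType) (theta d : R) : irrational theta -> 0 < d ->
  exists (q : nat) (a : int), (0 < q)%N /\ 0 < `|q%:R * theta - a%:~R| <= d.
Proof.
move=> irr d0.
pose fr (x : R) : R := x - (Num.floor x)%:~R.
have fr01 x : 0 <= fr x < 1.
  by rewrite /fr; have := floor_itv x; rewrite intrD; lra.
pose K := (Num.truncn d^-1).+1.
have K0 : (0 : R) < K%:R by rewrite ltr0n.
have KV : (K%:R)^-1 < d.
  by rewrite -[d]invrK ltf_pV2 ?posrE ?invr_gt0// /K truncnS_gt.
have hf n : (Num.truncn (K%:R * fr (n%:R * theta) : R)%R < K)%N.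
  have /andP[f0 f1] := fr01 (n%:R * theta).
  have K1 : (0 : R) <= K%:R by exact: ltW.
  by rewrite truncn_lt_nat ?mulr_ge0// -[ltRHS]mulr1 ltr_pM2l.
pose f (n : 'I_K.+1) : 'I_K := Ordinal (hf n).
have ninj : ~ injective f.
  by move=> /leq_card; rewrite !card_ord ltnn.
have [n [n' [nn' fe]]] : exists n n' : 'I_K.+1, (n < n')%N /\ f n = f n'.
  apply: contrapT => H; apply: ninj => a b fab.
  case: (ltngtP a b) => [ab|ba|/val_inj//]; exfalso; apply: H.
    by exists a, b.
  by exists b, a.
exists (n' - n)%N, (Num.floor (n'%:R * theta) - Num.floor (n%:R * theta)).
split; first by rewrite subn_gt0.
have E : (n' - n)%:R * theta - (Num.floor (n'%:R * theta) - Num.floor (n%:R * theta))%:~R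
   = fr (n'%:R * theta) - fr (n%:R * theta) :> R.
  by rewrite natrB ?(ltnW nn')// intrB /fr; ring.
rewrite E; apply/andP; split.
  rewrite normr_gt0 -E; apply/negP => /eqP h; apply: irr.
  have nz : (n' - n)%:R != 0 :> R by rewrite pnatr_eq0 -lt0n subn_gt0.
  exists ((Num.floor (n'%:R * theta) - Num.floor (n%:R * theta))%:Q / (n' - n)%:R) => //.
  rewrite fmorph_div /= ratr_nat ratr_int.
  by apply: (mulIf nz); rewrite divfK//; lra.
have /andP[a0 a1] := fr01 (n%:R * theta).
have /andP[b0 b1] := fr01 (n'%:R * theta).
have := congr1 val fe => /= fe'.
have h1 := @truncn_itv _ (K%:R * fr (n%:R * theta)) (mulr_ge0 (ltW K0) a0).
have h2 := @truncn_itv _ (K%:R * fr (n'%:R * theta)) (mulr_ge0 (ltW K0) b0).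
rewrite -fe' in h2.
have : `|K%:R * (fr (n'%:R * theta) - fr (n%:R * theta))| <= 1.
  by rewrite mulrBr ler_norml; move: h1 h2; rewrite -natr1; lra.
rewrite normrM gtr0_norm// => h.
by rewrite (le_trans _ (ltW KV))// -(ler_pM2l K0) divff ?gt_eqF.
Qed.

Lemma count_mul (p : pred nat) (q J : nat) :
  count p (iota 0 (J * q)) =
  (\sum_(0 <= i < q) count (fun j => p (j * q + i)%N) (iota 0 J))%N.
Proof.
have cE (a : pred nat) m n : count a (iota m n) = (\sum_(m <= i < m + n) a i)%N.
  by rewrite -sum1_count big_mkcond /index_iota addKn; apply: eq_bigr => i _; case: (a i).
rewrite cE add0n big_nat_mul.
under [RHS]eq_bigr do rewrite cE.
rewrite exchange_big; apply: eq_bigr => j _.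
by rewrite mulSn addnC -{1}[(j * q)%N]add0n big_addn addKn; under eq_bigr do rewrite addnC.
Qed.

(** Modulo 1 the points form a progression of step [e] making at most about one turn. The chosen
    terms fall into five classes, one per integer translate in [ks], each of at most 2l/|e| + 1 <=
    3l/|e| terms. *)
Lemma progression_count (R : realType) (e l : R) (J : nat) (y : nat -> R)
    (p : pred nat) :
  0 < `|e| -> `|e| <= l -> l < 1 -> J%:R * `|e| <= 1 + `|e| ->
  (forall j, exists k : int, y j.+1 - y j - e = k%:~R) ->
  (forall i j, p i -> p j -> `|y i - y j| <= l) ->
  (count p (iota 0 J))%:R <= 15 * l / `|e|.
Proof.
move=> e0 el l1 Je hy hp.
have hyn j : exists k : int, y j = y 0%N + j%:R * e + k%:~R.
  elim: j => [|j [k hk]]; first by exists 0; rewrite mul0r !addr0.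
  have [k' hk'] := hy j; exists (k + k').
  by rewrite intrD -natr1; lra.
rewrite -size_filter; set s := [seq j <- _ | _].
case sE : s => [|j0 s'].
  by rewrite divr_ge0// mulr_ge0// (le_trans _ el)// ltW.
rewrite -sE.
have ss j : j \in s -> p j && (j < J)%N by rewrite mem_filter mem_iota add0n.
have j0s : j0 \in s by rewrite sE mem_head.
have /andP[pj0 j0J] := ss _ j0s.
pose ks : seq int := [:: -2; -1; 0; 1; 2].
pose P (k : int) (j : nat) := `|(j%:R - j0%:R) * e + k%:~R| <= l.
have us : uniq s by rewrite filter_uniq// iota_uniq.
have cov j : j \in s -> has (P^~ j) ks.
  move=> js; have /andP[pj jJ] := ss _ js.
  have [k hk] := hyn j; have [k0 hk0] := hyn j0.
  have hP : P (k - k0) j.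
    rewrite /P (_ : _ + _ = y j - y j0); first exact: hp.
    by rewrite hk hk0 intrB; ring.
  have bnd : `|(j%:R - j0%:R) * e| <= 1 + `|e|.
    rewrite normrM (le_trans _ Je)// ler_wpM2r//.
    have : (j%:R : R) <= J%:R by rewrite ler_nat ltnW.
    have : (j0%:R : R) <= J%:R by rewrite ler_nat ltnW.
    have : (0 : R) <= j%:R by [].
    have : (0 : R) <= j0%:R by [].
    by rewrite ler_norml; lra.
  (* The progression moves by less than 2 and [l < 1], so the translate is one of five. *)
  have : `|(k - k0)%:~R : R| < 3%:~R.
    have := ler_normB ((j%:R - j0%:R) * e + (k - k0)%:~R) ((j%:R - j0%:R) * e).
    rewrite addrAC subrr add0r => /le_lt_trans; apply.
    by move: hP; rewrite /P => hP; lra.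
  rewrite -intr_norm ltr_int => k3.
  apply/hasP; exists (k - k0) => //.
  by move: k3; rewrite /ks !inE; lia.
have part k : (count (P k) s)%:R <= 2 * l / `|e| + 1.
  rewrite -size_filter; apply: size_le_diam; first exact: filter_uniq.
    by rewrite divr_ge0// mulr_ge0// (le_trans _ el)// ltW.
  move=> i j; rewrite !mem_filter /P => /andP[hi _] /andP[hj _].
  rewrite ler_pdivlMr//.
  have := ler_normB ((i%:R - j0%:R) * e + k%:~R) ((j%:R - j0%:R) * e + k%:~R).
  rewrite (_ : _ - _ = (i%:R - j%:R) * e); last by ring.
  rewrite normrM => h; have := ler_norm (i%:R - j%:R : R) => h'.
  have : (i%:R - j%:R) * `|e| <= `|i%:R - j%:R| * `|e| by rewrite ler_wpM2r// ltW.
  lra.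
have le1 : 1 <= l / `|e| by rewrite ler_pdivlMr// mul1r.
have : ((\sum_(k <- ks) count (P k) s)%N%:R : R) <= \sum_(k <- ks) (2 * l / `|e| + 1).
  by rewrite natr_sum; apply: ler_sum => k _.
rewrite big_const_seq /= => h.
apply: (@le_trans _ _ ((\sum_(k <- ks) count (P k) s)%N%:R)).
  by rewrite ler_nat; apply: size_le_cover.
move: h; lra.
Qed.

(** The orbit splits into q progressions whose step [q * theta - a] has modulus at most [delta], and
    J is about the number of steps in one turn. The length [L] depends on [theta] and [delta] only,
    not on the starting point. *)
Lemma rotation_count (R : realType) (theta delta : R) :
  irrational theta -> 0 < delta ->
  exists L : nat, (0 < L)%N /\ forall (x : nat -> R) (p : pred nat) (l : R),
    (forall n, exists k : int, x n.+1 - x n - theta = k%:~R) -> delta <= l ->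
    (forall m n, p m -> p n -> `|x m - x n| <= l) ->
    (count p (iota 0 L))%:R <= 15 * l * L%:R.
Proof.
move=> irr d0.
have [q [a [q0 /andP[e0 ed]]]] := dirichlet_approx irr d0.
set e := _ - _ in e0 ed.
pose J := (Num.truncn `|e|^-1).+1.
have Je1 : 1 <= J%:R * `|e| by rewrite -ler_pdivrMr// mul1r /J ltW// truncnS_gt.
have Je2 : J%:R * `|e| <= 1 + `|e|.
  rewrite /J -natr1 mulrDl mul1r lerD2r -ler_pdivlMr// mul1r truncn_le.
  by rewrite invr_ge0.
exists (J * q)%N; split; first by rewrite muln_gt0.
move=> x p l hx dl hp.
have l0 : 0 < l by exact: lt_le_trans dl.
have [l1|l1] := leP 1 l.
  apply: (@le_trans _ _ (J * q)%:R).
    by rewrite ler_nat (leq_trans (count_size _ _))// size_iota.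
  by rewrite ler_peMl//; lra.
have hxn n m : exists k : int, x (n + m)%N - x n - m%:R * theta = k%:~R.
  elim: m => [|m [k hk]]; first by exists 0; rewrite addn0 mul0r; lra.
  have [k' hk'] := hx (n + m)%N; exists (k + k').
  by rewrite intrD addnS -natr1; lra.
rewrite count_mul natr_sum natrM.
apply: (@le_trans _ _ (\sum_(0 <= i < q) (15 * l * J%:R))); last first.
  by rewrite sumr_const_nat subn0 -[_ *+ q]mulr_natr mulrA.
apply: ler_sum => i _.
apply: (@le_trans _ _ (15 * l / `|e|)).
  apply: (@progression_count _ e l J (fun j => x (j * q + i)%N)) => //.
  - exact: le_trans ed dl.
  - move=> j; have [k hk] := hxn (j * q + i)%N q; exists (k + a).
    rewrite intrD -hk mulSn [(q + _)%N]addnC addnAC /e; ring.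
  - by move=> j j'; exact: hp.
by rewrite ler_pM2l ?mulr_gt0// /J ltW// truncnS_gt.
Qed.

(** * Rescaled pieces of invariant sets *)

Section Pieces.
Variable R : realType.
Implicit Types (q r d n : nat) (X Z : set R).

(* [piece q d Z] is the part of Z in [d/q, (d+1)/q), rescaled to [0, 1). *)
Definition piece q d Z : set R := [set w | 0 <= w < 1 /\ Z ((d%:R + w) / q%:R)].

(** The range includes q: cells are half open, so the point 1 lies in cell q. *)
Definition digits q Z : seq nat :=
  [seq d <- iota 0 q.+1 | `[< piece q d Z !=set0 >]].

Definition piece_closed r X : Prop :=
  X `<=` `[0, 1] /\ forall n d, piece (r ^ n) d X `<=` X.

Lemma digits_uniq q Z : uniq (digits q Z).
Proof. by rewrite filter_uniq// iota_uniq. Qed.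

Lemma mem_digits q Z d w : (0 < q)%N -> Z `<=` `[0, 1] -> piece q d Z w ->
  d \in digits q Z.
Proof.
move=> q0 Z01 pw; rewrite mem_filter; apply/andP; split; first by apply/asboolP; exists w.
rewrite mem_iota add0n ltnS leq0n -(ler_nat R) /=.
have [/andP[w0 w1] /Z01] := pw; rewrite /= in_itv /= => /andP[_].
by rewrite ler_pdivrMr ?ltr0n// mul1r; lra.
Qed.

Lemma digits_piece q Z d : d \in digits q Z -> piece q d Z !=set0.
Proof. by rewrite mem_filter => /andP[/asboolP]. Qed.

Lemma digits_ex q Z z : (0 < q)%N -> Z `<=` `[0, 1] -> Z z ->
  exists d w, [/\ d \in digits q Z, piece q d Z w & z = (d%:R + w) / q%:R].
Proof.
move=> q0 Z01 Zz.
have qR : 0 < q%:R :> R by rewrite ltr0n.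
have /andP[z0 z1] : 0 <= z <= 1 by have := Z01 _ Zz; rewrite /= in_itv.
have := @truncn_itv _ (q%:R * z) (mulr_ge0 (ltW qR) z0).
set d := Num.truncn _ => hd; pose w := q%:R * z - d%:R.
have zE : z = (d%:R + w) / q%:R by rewrite /w addrC subrK mulrC mulKf ?gt_eqF.
have pw : piece q d Z w.
  split; [|by rewrite -zE].
  move: hd; rewrite -natr1 /w; lra.
by exists d, w; split => //; apply: mem_digits pw.
Qed.

Lemma piece_sub q d X Z : Z `<=` X -> piece q d Z `<=` piece q d X.
Proof. by move=> ZX w [w01 /ZX]. Qed.

Lemma piece_unit q d Z : piece q d Z `<=` `[0, 1].
Proof. by move=> w [/andP[w0 w1] _]; rewrite /= in_itv /= w0 ltW. Qed.

Lemma digits_sub q X Z : Z `<=` X -> {subset digits q Z <= digits q X}.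
Proof.
move=> ZX d; rewrite !mem_filter => /andP[/asboolP[w pw] ->]; rewrite andbT.
by apply/asboolP; exists w; apply: piece_sub ZX _ pw.
Qed.

Lemma size_digits_sub q X Z : Z `<=` X -> (size (digits q Z) <= size (digits q X))%N.
Proof. by move=> ZX; apply: uniq_leq_size (digits_uniq _ _) (digits_sub ZX). Qed.

Lemma piece_mul q q' D Z : (0 < q)%N -> (0 < q')%N ->
  piece (q * q') D Z `<=` piece q' (D %% q') (piece q (D %/ q') Z).
Proof.
move=> q0 q'0 w [/andP[w0 w1] Zw].
have q'R : 0 < q'%:R :> R by rewrite ltr0n.
have qR : 0 < q%:R :> R by rewrite ltr0n.
split; first by rewrite w0 w1.
split.
  rewrite divr_ge0 ?addr_ge0// ltr_pdivrMr// mul1r.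
  have : (D %% q').+1%:R <= q'%:R :> R by rewrite ler_nat ltn_mod.
  by rewrite -natr1; lra.
rewrite [X in Z X](_ : _ = (D%:R + w) / (q * q')%:R)//.
rewrite {3}(divn_eq D q') natrD !natrM.
by field; rewrite !gt_eqF.
Qed.

Lemma times_invariant_piece r X : (0 < r)%N -> times_invariant r X -> piece_closed r X.
Proof.
move=> r0 [X01 _ TX]; split => // n.
have T1 d : piece r d X `<=` X.
  move=> w [/andP[w0 w1] Xw].
  have <- : times_map r ((d%:R + w) / r%:R) = w; last by apply: TX; exists ((d%:R + w) / r%:R).
  rewrite /times_map mulrC divfK ?pnatr_eq0 -?lt0n//.
  rewrite (@floor_def _ _ d%:Z) ?pmulrn//; first by rewrite -pmulrn; lra.
  by rewrite intrD -!pmulrn; lra.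
elim: n => [|n IH] d.
  rewrite expn0 => w [/andP[w0 w1]]; rewrite divr1 => Xw.
  have /andP[h0 h1] : 0 <= d%:R + w <= 1 by have := X01 _ Xw; rewrite /= in_itv.
  (* At scale 1, a cell other than the first can only hold the point 1, which rescales to 0; this
     lies in X because [times_map r] sends 1 to 0. *)
  case: d Xw h0 h1 => [|d]; first by rewrite add0r.
  rewrite -natr1 => Xw h0 h1.
  have w00 : w = 0 by have : (0 : R) <= d%:R by []; lra.
  have d0 : d%:R = 0 :> R by have : (0 : R) <= d%:R by []; lra.
  move: Xw; rewrite w00 d0 add0r addr0 => X1.
  apply: (T1 r); split; first by rewrite lexx ltr01.
  by rewrite addr0 divff// pnatr_eq0 -lt0n.
rewrite expnSr => w pw.
have := @piece_mul (r ^ n) r _ _ _ r0 _ pw; rewrite expn_gt0 r0 => /(_ isT) h.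
by apply: T1 (piece_sub (IH _) h).
Qed.

End Pieces.

(** * Content of r-adic covers and the critical exponent *)

Section Covers.
Variable R : realType.
Variable r : nat.
Hypothesis r1 : (1 < r)%N.
Implicit Types (X Z : set R) (c : seq (nat * nat)) (s : R).

(** The pair (n, d) stands for the cell [d / r^n, (d + 1) / r^n). Covers are finite lists whose
    cells may have different levels. *)
Definition tree_cover c Z : Prop := forall z, Z z ->
  exists2 p, p \in c & p.2%:R <= (r ^ p.1)%:R * z < p.2%:R + 1.

Definition weight s c : R := \sum_(p <- c) (r ^ p.1)%:R `^ (- s).

Lemma expr_gt0 n : (0 < r ^ n)%N.
Proof. by rewrite expn_gt0 ltnW. Qed.

Lemma exprR_gt0 n : (0 : R) < (r ^ n)%:R.
Proof. by rewrite ltr0n expr_gt0. Qed.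

Lemma exprR_ge1 n : (1 : R) <= (r ^ n)%:R.
Proof. by rewrite ler1n expr_gt0. Qed.

Lemma block_count q e (t s : seq nat) : (0 < q)%N -> uniq s ->
  (count (fun D => (D %/ q == e) && (D %% q \in t)) s <= size t)%N.
Proof.
move=> q0 us; rewrite -size_filter -(size_map (fun d => e * q + d)%N t).
apply: uniq_leq_size; first exact: filter_uniq.
move=> D; rewrite mem_filter => /andP[/andP[/eqP <- Dt] _].
by apply/mapP; exists (D %% q)%N => //; exact: divn_eq.
Qed.

Lemma weight_ge0 s c : 0 <= weight s c.
Proof. by apply: sumr_ge0 => p _; exact: powR_ge0. Qed.

Lemma weight_mem s c p : p \in c -> (r ^ p.1)%:R `^ (- s) <= weight s c.
Proof.
move=> pc; rewrite /weight (big_rem p pc) /= lerDl.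
by apply: sumr_ge0 => q _; exact: powR_ge0.
Qed.

(* Furstenberg: by invariance an r-adic cover of weight less than 1 can be
   iterated inside each of its own cells. *)
Lemma cover_count X s c : piece_closed r X -> 0 <= s -> tree_cover c X ->
  weight s c < 1 ->
  exists2 C, 0 < C & forall k, (size (digits (r ^ k) X))%:R <= C * (r ^ k)%:R `^ s.
Proof.
move=> [X01 Xcl] s0 cov w1.
pose m := (\max_(p <- c) p.1)%N.
pose C : R := (r ^ m).+1%:R.
exists C; first by rewrite ltr0n.
have pge1 k : 1 <= (r ^ k)%:R `^ s :> R.
  by rewrite -[leLHS](powRr0 (r ^ k)%:R) ler_powR// exprR_ge1.
elim/ltn_ind => k IH; have [km|mk] := leqP k m.
  apply: (@le_trans _ _ C); last by rewrite ler_peMr// ler0n.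
  rewrite ler_nat; apply: leq_trans (_ : (r ^ k).+1 <= _)%N.
    by rewrite /digits size_filter (leq_trans (count_size _ _))// size_iota.
  by rewrite ltnS leq_exp2l.
(* A cell of level 0 alone would have weight 1; so all levels are positive and each cell leads back
   to a smaller [k]. *)
have lev p : p \in c -> (0 < p.1 <= m)%N.
  move=> pc; apply/andP; split; last by rewrite /m leq_bigmax_seq.
  rewrite lt0n; apply/negP => /eqP p0.
  by have := weight_mem s pc; rewrite p0 expn0 powR1 leNgt w1.
(* [D] lies in the cell [p], and its position inside [p] is again a digit of X by invariance. *)
pose P (p : nat * nat) D := (D %/ r ^ (k - p.1) == p.2)%N &&
  (D %% r ^ (k - p.1) \in digits (r ^ (k - p.1)) X)%N.
have covD : {in digits (r ^ k) X, forall D, has (P^~ D) c}.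
  move=> D /digits_piece[w pw].
  have [/andP[w0 w1'] Xz] := pw.
  have [p pc hp] := cov _ Xz.
  apply/hasP; exists p => //; rewrite /P.
  have /andP[_ pm] := lev _ pc.
  have pk : (p.1 <= k)%N by rewrite (leq_trans pm)// ltnW.
  have kE : (r ^ k = r ^ p.1 * r ^ (k - p.1))%N by rewrite -expnD subnKC.
  have hE : (r ^ p.1)%:R * ((D%:R + w) / (r ^ k)%:R) = (D%:R + w) / (r ^ (k - p.1))%:R :> R.
    by rewrite kE natrM; field; rewrite !gt_eqF// exprR_gt0.
  have q0 := exprR_gt0 (k - p.1).
  move: hp; rewrite hE ler_pdivlMr// ltr_pdivrMr// => /andP[h1 h2].
  have DE : (D %/ r ^ (k - p.1) = p.2)%N.
    apply/eqP; rewrite eqn_leq -ltnS ltn_divLR ?expr_gt0// leq_divRL ?expr_gt0//.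
    rewrite -(ltr_nat R) -ltnS -(ltr_nat R) !natrM -!natr1.
    by apply/andP; split; lra.
  rewrite DE eqxx /=; apply: (@mem_digits _ _ _ _ w) => //; first exact: expr_gt0.
  rewrite kE in pw; have := piece_mul (expr_gt0 _) (expr_gt0 _) pw.
  by apply: piece_sub; exact: Xcl.
have hs := size_le_cover covD.
apply: (@le_trans _ _ (\sum_(p <- c) C * (r ^ k)%:R `^ s * (r ^ p.1)%:R `^ (- s))).
  apply: (@le_trans _ _ ((\sum_(p <- c) count (P p) (digits (r ^ k) X))%N%:R)).
    by rewrite ler_nat.
  rewrite natr_sum big_seq [leRHS]big_seq; apply: ler_sum => p pc.
  have /andP[p0 pm] := lev _ pc.
  have pk : (p.1 <= k)%N by rewrite (leq_trans pm)// ltnW.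
  apply: (@le_trans _ _ (C * (r ^ (k - p.1))%:R `^ s)).
    apply: le_trans (IH (k - p.1)%N _); last by rewrite ltn_subrL p0 (leq_trans _ mk).
    by rewrite ler_nat block_count ?expr_gt0// digits_uniq.
  rewrite -mulrA ler_pM2l ?ltr0n// -{2}(subnK pk) expnD natrM powRM ?ler0n//.
  by rewrite -mulrA powRN divff ?mulr1// gt_eqF// powR_gt0// exprR_gt0.
rewrite -mulr_sumr -/(weight s c) ler_piMr ?mulr_ge0 ?powR_ge0 ?ler0n//.
exact: ltW.
Qed.

Lemma tree_cover01 X : X `<=` `[0, 1] -> tree_cover [:: (0, 0); (0, 1)]%N X.
Proof.
move=> X01 z /X01; rewrite /= in_itv /= => /andP[z0 z1].
have [z1'|z1'] := ltP z 1.
  by exists (0, 0)%N; rewrite ?inE//= expn0 mul1r add0r z0.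
by exists (0, 1)%N; rewrite ?inE//= expn0 mul1r z1'/=; lra.
Qed.

Lemma tree_cover_level X k : X `<=` `[0, 1] ->
  tree_cover [seq (k, d) | d <- digits (r ^ k) X] X.
Proof.
move=> X01 z Xz; have [d [w [dd pw ->]]] := digits_ex (expr_gt0 k) X01 Xz.
exists (k, d); first by apply/mapP; exists d.
have [/andP[w0 w1] _] := pw.
by rewrite /= mulrC divfK ?gt_eqF ?exprR_gt0//; lra.
Qed.

End Covers.

Lemma powR_large (R : realType) (K tau : R) : 0 < tau ->
  exists2 Q0 : R, 1 <= Q0 & forall Q, Q0 <= Q -> K <= Q `^ tau.
Proof.
move=> t0; pose K1 := Num.max 1 K.
have K11 : 1 <= K1 by rewrite le_max lexx.
have K1t : 1 <= K1 `^ tau^-1.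
  by rewrite -[leLHS](powRr0 K1) ler_powR// invr_ge0 ltW.
exists (K1 `^ tau^-1) => // Q hQ.
apply: (@le_trans _ _ K1); first by rewrite le_max lexx orbT.
apply: (@le_trans _ _ ((K1 `^ tau^-1) `^ tau)).
  by rewrite -powRrM mulVf ?gt_eqF// powRr1// (le_trans _ K11).
by rewrite ge0_ler_powR ?nnegrE ?powR_ge0// ?(ltW t0)//; lra.
Qed.

Lemma expn_large (R : realType) (r : nat) (K : R) : (1 < r)%N ->
  exists k, K <= (r ^ k)%:R.
Proof.
move=> r1; exists (Num.truncn K).+1; apply: (@le_trans _ _ (Num.truncn K).+1%:R).
  by rewrite ltW// truncnS_gt.
by rewrite ler_nat ltnW// ltn_expl.
Qed.

(** Covering by the cells of length 1/q costs at most C q^(s - s'), which tends to 0. *)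
Lemma dim_le_count (R : realType) (r : nat) (X : set R) (s s' C : R) :
  (1 < r)%N -> X `<=` `[0, 1] -> 0 < C ->
  (forall k, (size (digits (r ^ k) X))%:R <= C * (r ^ k)%:R `^ s) ->
  0 <= s' -> s < s' -> (hausdorff_dim X <= s'%:E)%E.
Proof.
move=> r1 X01 C0 hC s'0 ss'.
apply: ereal_inf_lbound; exists s' => //; split => //.
have pm0 d : (0 <= hausdorff_premeasure s' d X)%E.
  apply: le_ereal_inf_tmp => _ [D [U [_ _ ->]]].
  by apply: esum_ge0 => i _; exact: poweR_ge0.
apply/eqP; rewrite eq_le; apply/andP; split; last first.
  apply: le_trans (pm0 1) _; apply: ereal_sup_ubound; exists 1 => //=.
apply: ge_ereal_sup => _ [d /= d0 <-].
apply/lee_addgt0Pr => e e0; rewrite add0e.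
have [Q0 Q01 hQ0] := @powR_large R (C / e) (s' - s) ltac:(lra).
(* Taking [q] above both [Q0] and 1/d makes the sum at most [e] and the cells no longer than [d]. *)
have [k hk] := @expn_large R r (Q0 + d^-1) r1.
set q := (r ^ k)%N in hk.
have q0 : 0 < q%:R :> R by exact: exprR_gt0.
have d'0 : 0 < d^-1 by rewrite invr_gt0.
have qd : q%:R^-1 <= d by rewrite -[d]invrK lef_pV2 ?posrE//; lra.
pose U n : set R := [set z | n%:R <= q%:R * z < n%:R + 1].
have dU n : (diameter (U n) <= (q%:R^-1)%:E)%E.
  rewrite /diameter ge_max lee_fin invr_ge0 ltW//=.
  apply: ge_ereal_sup => _ [x Ux [y Uy <-]]; rewrite lee_fin.
  move: Ux Uy; rewrite /U /= => Ux Uy.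
  rewrite -(ler_pM2l q0) divff ?gt_eqF// -[q%:R in leLHS]gtr0_norm// -normrM.
  by rewrite ler_norml mulrBr; lra.
apply: ereal_inf_le; exists (\esum_(i in [set` digits q X]) (diameter (U i) `^ s'))%E.
  exists [set` digits q X], U; split => //.
    by move=> i _; apply: le_trans (dU i) _; rewrite lee_fin.
  move=> z Xz; have [n [w [nd [/andP[w0 w1] _] ->]]] := digits_ex (expr_gt0 r1 k) X01 Xz.
  by exists n => //; rewrite /U /= mulrC divfK ?gt_eqF//; lra.
apply: (@le_trans _ _ (\esum_(i in [set` digits q X]) ((q%:R^-1) `^ s')%:E)%E).
  apply: le_esum => i _; rewrite -poweR_EFin; apply: gt0_ler_poweR => //.
  - by rewrite in_itv /= leey andbT /diameter le_max lexx.
  - by rewrite in_itv /= leey andbT lee_fin invr_ge0 ltW.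
rewrite esum_fset; last 2 first.
- exact: finite_seq.
- by move=> i _; rewrite lee_fin powR_ge0.
rewrite -(fsbig_seq _ _ (digits_uniq _ _)) sumEFin lee_fin.
rewrite big_const_seq count_predT iter_addr addr0 -[_ *+ _]mulr_natl.
apply: (@le_trans _ _ (C * q%:R `^ s * (q%:R^-1) `^ s')).
  by rewrite ler_wpM2r ?powR_ge0//; exact: hC.
have -> : (q%:R^-1) `^ s' = (q%:R : R) `^ (- s').
  by rewrite -powR_inv1 ?ler0n// -powRrM mulN1r.
rewrite -mulrA -powRD; last by rewrite (gt_eqF q0) implybT.
rewrite (_ : s - s' = - (s' - s)) ?powRN; last by ring.
rewrite ler_pdivrMr ?powR_gt0// mulrC -ler_pdivrMr//.
by apply: hQ0; lra.
Qed.

(** A Hausdorff content restricted to finite covers by r-adic cells: it behaves well under zooming,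
    and [cover_count] applies to its covers. *)
Definition content (R : realType) (r : nat) (s : R) (Z : set R) : R :=
  inf [set weight r s c | c in (tree_cover r)^~ Z].

Section Content.
Variables (R : realType) (r : nat).
Hypothesis r1 : (1 < r)%N.
Implicit Types (X Z : set R) (s x : R).

Lemma has_lbound_weights s Z : has_lbound [set weight r s c | c in (tree_cover r)^~ Z].
Proof. by exists 0 => _ [c _ <-]; exact: weight_ge0. Qed.

Lemma content_le s Z c : tree_cover r c Z -> content r s Z <= weight r s c.
Proof. by move=> h; apply: (ge_inf (has_lbound_weights s Z)); exists c. Qed.

Lemma le_content s Z x : Z `<=` `[0, 1] ->
  (forall c, tree_cover r c Z -> x <= weight r s c) -> x <= content r s Z.
Proof.
move=> Z01 h; apply: lb_le_inf => [|_ [c hc <-]]; last exact: h.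
by exists (weight r s [:: (0, 0); (0, 1)]%N); eexists; [exact: tree_cover01|].
Qed.

Lemma content_piece_le1 s q d Z : content r s (piece q d Z) <= 1.
Proof.
apply: (@le_trans _ _ (weight r s [:: (0, 0)]%N)).
  apply: content_le => w [/andP[w0 w1] _]; exists (0, 0)%N; rewrite ?mem_head//=.
  by rewrite expn0 mul1r add0r w0.
by rewrite /weight big_seq1 /= expn0 powR1.
Qed.

Lemma content_gt0_neq0 s Z : 0 < content r s Z -> Z !=set0.
Proof.
move=> h; apply: contrapT => /nonemptyPn Z0; move: h; rewrite ltNge => /negP; apply.
have -> : 0 = weight r s [::] by rewrite /weight big_nil.
by apply: content_le => z; rewrite Z0.
Qed.

(** Nearly optimal covers of the pieces, moved back into their cells, together cover Z; moving down
    N levels multiplies weights by [q ^ (- s)]. *)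
Lemma content_split s N Z : Z `<=` `[0, 1] ->
  content r s Z <= (r ^ N)%:R `^ (- s) *
    \sum_(d <- digits (r ^ N) Z) content r s (piece (r ^ N) d Z).
Proof.
move=> Z01; set q := (r ^ N)%N; set A := _ * _; set D := digits q Z.
have q0 : 0 < q%:R :> R by exact: exprR_gt0.
pose K := q%:R `^ (- s) * (size D)%:R.
have K0 : 0 <= K by rewrite mulr_ge0 ?powR_ge0.
suff H e : 0 < e -> content r s Z <= A + K * e.
  rewrite leNgt; apply/negP => lt.
  have K1 : 0 < K + 1 by lra.
  have := H ((content r s Z - A) / (K + 1) / 2); rewrite !divr_gt0 ?subr_gt0//.
  move=> /(_ isT); apply/negP; rewrite -ltNge.
  have : K * ((content r s Z - A) / (K + 1) / 2) <= (content r s Z - A) / 2.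
    rewrite !mulrA ler_pM2r// ler_pdivrMr// mulrC ler_wpM2l//; lra.
  lra.
move=> e0.
have hex d : exists c, tree_cover r c (piece q d Z) /\
    weight r s c < content r s (piece q d Z) + e.
  have [|_ [c hc <-] lt] := @inf_adherent _ [set weight r s c | c in (tree_cover r)^~ (piece q d Z)] _ e0.
    split; last exact: has_lbound_weights.
    by exists (weight r s [:: (0, 0); (0, 1)]%N); eexists;
      [apply: tree_cover01; exact: piece_unit|].
  by exists c.
have [f hf] := choice hex.
pose g d (p : nat * nat) := ((N + p.1)%N, (d * r ^ p.1 + p.2)%N).
pose c := flatten [seq [seq g d p | p <- f d] | d <- D].
have cc : tree_cover r c Z.
  move=> z Zz; have [d [w [dd pw ->]]] := digits_ex (expr_gt0 r1 N) Z01 Zz.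
  have [p pf hp] := (hf d).1 _ pw.
  exists (g d p).
    by apply/flatten_mapP; exists d => //; apply/mapP; exists p.
  rewrite /g /= expnD natrM mulrAC -/q mulrCA mulfV ?gt_eqF//.
  by rewrite natrD natrM; lra.
apply: (le_trans (content_le s cc)).
rewrite /weight /c big_flatten big_map /=.
under eq_bigr => d _.
  rewrite big_map /=.
  under eq_bigr => p _ do rewrite expnD natrM powRM//.
  rewrite -mulr_sumr -/(weight r s (f d)).
  over.
rewrite /= -mulr_sumr /A /K -mulrA -mulrDr ler_wpM2l ?powR_ge0//.
apply: (@le_trans _ _ (\sum_(d <- D) (content r s (piece q d Z) + e))).
  by apply: ler_sum => d _; exact: ltW (hf d).2.
by rewrite big_split /= lerD2l big_const_seq count_predT iter_addr addr0 mulr_natl.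
Qed.

(* The exponent is the infimum of the [s] admitting a finite r-adic cover of
   weight less than 1: below it the content of X is at least 1, above it
   [cover_count] controls all the digit counts. *)
Lemma critical_exponent X : piece_closed r X -> X !=set0 ->
  exists alpha : R, [/\ 0 <= alpha, (hausdorff_dim X <= alpha%:E)%E &
    forall e, 0 < e -> 1 <= content r (alpha - e) X /\
      exists2 C, 0 < C & forall k,
        (size (digits (r ^ k) X))%:R <= C * (r ^ k)%:R `^ (alpha + e)].
Proof.
move=> Xc [x0 Xx0]; have X01 := Xc.1.
pose E := [set s : R | exists c, tree_cover r c X /\ weight r s c < 1].
(* With [s <= 0] a single cell would already weigh at least 1. *)
have E0 s : E s -> 0 < s.
  move=> [c [cc cw]]; rewrite ltNge; apply/negP => s0.
  have [p pc _] := cc _ Xx0.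
  have := le_lt_trans (weight_mem r s pc) cw; rewrite ltNge => /negP; apply.
  by rewrite -[leLHS](powRr0 (r ^ p.1)%:R) ler_powR ?exprR_ge1//; lra.
have En : E !=set0.
  have [Q0 _ hQ] := @powR_large R 3 1 ltr01.
  have [k hk] := @expn_large R r (Num.max Q0 3) r1.
  have /hQ h3 : Q0 <= (r ^ k)%:R by apply: le_trans hk; rewrite le_max lexx.
  (* With exponent 2, the at most q + 1 cells of a level with q >= 3 weigh at most (q + 1) / q^2 <
     1. *)
  exists 2, [seq (k, d) | d <- digits (r ^ k) X]; split; first exact: tree_cover_level.
  rewrite /weight big_map /= big_const_seq count_predT iter_addr addr0 -[_ *+ _]mulr_natl.
  have q0 := @exprR_gt0 R r r1 k.
  rewrite powRN powR_mulrn ?ler0n// ltr_pdivrMr ?exprn_gt0// mul1r.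
  have : (size (digits (r ^ k) X))%:R <= (r ^ k)%:R + 1 :> R.
    rewrite natr1 ler_nat /digits size_filter (leq_trans (count_size _ _))//.
    by rewrite size_iota.
  move: h3; rewrite powRr1 ?ler0n//; set q : R := (r ^ k)%:R => h3 hs.
  have : 3 * q <= q ^+ 2 by rewrite expr2 ler_pM2r.
  by lra.
have Eb : has_lbound E by exists 0 => s /E0/ltW.
have a0 : 0 <= inf E by apply: lb_le_inf => // s /E0/ltW.
have above e : 0 < e -> exists s C, [/\ s < inf E + e, 0 < C &
    forall k, (size (digits (r ^ k) X))%:R <= C * (r ^ k)%:R `^ s].
  move=> e0; have [s Es se] := inf_adherent e0 (conj En Eb).
  have [c [cc cw]] := Es.
  have [C C0 hC] := cover_count r1 Xc (ltW (E0 _ Es)) cc cw.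
  by exists s, C; split.
exists (inf E); split => //.
  apply/lee_addgt0Pr => e e0; have [s [C [se C0 hC]]] := above _ e0.
  by apply: (dim_le_count r1 X01 C0 hC) => //; lra.
move=> e e0; split.
  apply: le_content => // c cc; rewrite leNgt; apply/negP => cw.
  have : inf E <= inf E - e by apply: (ge_inf Eb); exists c.
  by lra.
have [s [C [se C0 hC]]] := above _ e0.
exists C => // k; apply: le_trans (hC k) _.
by rewrite ler_pM2l// ler_powR ?exprR_ge1// ltW.
Qed.

End Content.

(** * Digit counts *)

Section Counting.
Variables (R : realType) (r : nat).
Hypothesis r1 : (1 < r)%N.
Implicit Types (X Z : set R).

Lemma mem_digits_mod X n k D : piece_closed r X -> (k <= n)%N ->
  D \in digits (r ^ n) X -> (D %% r ^ k)%N \in digits (r ^ k) X.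
Proof.
move=> [X01 Xcl] kn /digits_piece[w].
rewrite -{1}(subnK kn) expnD => /(piece_mul (expr_gt0 r1 _) (expr_gt0 r1 _)) pw.
by apply: (mem_digits (expr_gt0 r1 k) X01); apply: piece_sub pw; exact: Xcl.
Qed.

(** With [r ^ k] the least power not below [D], the window meets at most four blocks of length
    [r ^ k], and by invariance the positions inside a block are digits of X at level k. *)
Lemma local_count X (s C : R) : piece_closed r X -> 0 <= s -> 0 < C ->
  (forall k, (size (digits (r ^ k) X))%:R <= C * (r ^ k)%:R `^ s) ->
  exists2 C' : R, 0 < C' & forall n (u D : R), 1 <= D ->
    (count (fun i => `|i%:R - u| <= D) (digits (r ^ n) X))%:R <= C' * D `^ s.
Proof.
move=> Xc s0 C0 hC.
exists (4 * (C * r%:R `^ s)); first by rewrite !mulr_gt0// powR_gt0// ltr0n ltnW.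
move=> n u D D1.
have [k Dk kD] : exists2 k, D <= (r ^ k)%:R & (r ^ k)%:R <= r%:R * D.
  have ex : exists k, D <= (r ^ k)%:R by exact: expn_large.
  case: (ex_minnP ex) => k Dk kmin; exists k => //.
  case: k kmin {Dk} => [|k] kmin; first by rewrite -[leLHS]mul1r ler_pM// ler1n ltnW.
  rewrite expnS natrM ler_pM2l ?ltr0n ?(ltnW r1)// leNgt; apply/negP => lt.
  by have := kmin k (ltW lt); rewrite ltnn.
have hk : (size (digits (r ^ k) X))%:R <= C * r%:R `^ s * D `^ s.
  apply: le_trans (hC k) _; rewrite -mulrA ler_pM2l// -powRM ?ler0n//; last lra.
  by rewrite ge0_ler_powR ?nnegrE ?ler0n// mulr_ge0 ?ler0n//; lra.
(* If [n <= k], the number of all digits is already small enough. *)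
have [nk|kn] := leqP n k.
  apply: (@le_trans _ _ (size (digits (r ^ n) X))%:R); first by rewrite ler_nat count_size.
  apply: (@le_trans _ _ (C * r%:R `^ s * D `^ s)); last first.
    have : 0 <= C * r%:R `^ s * D `^ s by rewrite !mulr_ge0 ?powR_ge0// ltW.
    by lra.
  apply: le_trans (hC n) _; rewrite -mulrA ler_pM2l// -powRM ?ler0n//; last lra.
  rewrite ge0_ler_powR ?nnegrE ?ler0n//; first by rewrite mulr_ge0 ?ler0n//; lra.
  by apply: le_trans kD; rewrite ler_nat leq_exp2l.
rewrite -size_filter; set S := [seq i <- _ | _].
pose T := undup [seq (i %/ r ^ k)%N | i <- S].
have q0 := @exprR_gt0 R _ r1 k.
have hT : (size T)%:R <= (3 : R) + 1.
  apply: size_le_diam; [exact: undup_uniq|by []|].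
  move=> a b; rewrite !mem_undup => /mapP[i iS ->] /mapP[j jS ->].
  move: iS jS; rewrite !mem_filter => /andP[hi _] /andP[hj _].
  have ij : (i%:R : R) - j%:R <= 2 * (r ^ k)%:R by move: hi hj; rewrite !ler_norml; lra.
  have h1 : (i %/ r ^ k)%:R * (r ^ k)%:R <= i%:R :> R by rewrite -natrM ler_nat leq_divM.
  have h2 : (j%:R : R) <= ((j %/ r ^ k)%:R + 1) * (r ^ k)%:R.
    by rewrite natr1 -natrM ler_nat ltnW// ltn_ceil// expr_gt0.
  rewrite -(ler_pM2r q0); lra.
pose P e i := ((i %/ r ^ k == e) && (i %% r ^ k \in digits (r ^ k) X))%N.
have cov : {in S, forall i, has (P^~ i) T}.
  move=> i iS; apply/hasP; exists (i %/ r ^ k)%N.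
    by rewrite mem_undup; apply/mapP; exists i.
  rewrite /P eqxx /=; apply: (mem_digits_mod Xc (ltnW kn)).
  by move: iS; rewrite mem_filter => /andP[].
apply: (@le_trans _ _ ((\sum_(e <- T) count (P e) S)%N%:R)).
  by rewrite ler_nat; exact: size_le_cover.
rewrite natr_sum; apply: (@le_trans _ _ (\sum_(e <- T) C * r%:R `^ s * D `^ s)).
  apply: ler_sum => e _; apply: le_trans hk; rewrite ler_nat.
  by apply: block_count; [exact: expr_gt0|rewrite filter_uniq// digits_uniq].
rewrite big_const_seq count_predT iter_addr addr0 -[_ *+ _]mulr_natl -mulrA.
rewrite [leRHS](_ : _ = 4 * (C * (r%:R `^ s * D `^ s))); last by ring.
by rewrite ler_wpM2r ?mulr_ge0 ?powR_ge0// ?(ltW C0)//; lra.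
Qed.

(* As the number of pieces is at most about q^alpha, a set of content at least x
   either has about q^alpha pieces of content not much smaller than x, or has a
   piece whose content is larger than x by a definite power of Q. *)
Lemma rich_or_poor X (alpha e kappa C c : R) : piece_closed r X ->
  0 <= alpha -> 0 < e -> 0 < C -> 1 <= c ->
  (forall k, (size (digits (r ^ k) X))%:R <= C * (r ^ k)%:R `^ (alpha + e)) ->
  exists2 Q0 : R, 1 <= Q0 & forall (Q : R) n, Q0 <= Q ->
    Q / c <= (r ^ n)%:R <= c * Q -> forall Z x, Z `<=` X -> 0 < x ->
    x <= content r (alpha - e) Z ->
    exists D : seq nat, [/\ uniq D, (0 < size D)%N,
      {in D, forall d, Q `^ (- (5 * e)) * x <=
         content r (alpha - e) (piece (r ^ n) d Z)},
      {subset D <= digits (r ^ n) Z} &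
      (exists2 d, d \in D & Q `^ kappa * x <=
         content r (alpha - e) (piece (r ^ n) d Z)) \/
      Q `^ (alpha - 2 * e - kappa) <= (size D)%:R].
Proof.
move=> Xc a0 e0 C0 c1 hC; have X01 := Xc.1.
(* [Q1] absorbs the constants in the estimate of the discarded pieces, [Q2] those in passing from
   [r ^ n] to the comparable scale [Q]. *)
have [Q1 Q11 hQ1] := @powR_large R (2 * (C * c `^ (2 * e))) (3 * e) ltac:(lra).
have [Q2 Q21 hQ2] := @powR_large R (2 * c `^ (alpha + e)) e e0.
exists (Num.max Q1 Q2) => [|Q n hQ /andP[Qq qQ] Z x ZX x0 xZ]; first by rewrite le_max Q11.
have {}hQ1 : 2 * (C * c `^ (2 * e)) <= Q `^ (3 * e).
  by apply: hQ1; apply: le_trans hQ; rewrite le_max lexx.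
have {}hQ2 : 2 * c `^ (alpha + e) <= Q `^ e.
  by apply: hQ2; apply: le_trans hQ; rewrite le_max lexx orbT.
have Q0 : 0 < Q.
  by apply: lt_le_trans hQ; apply: lt_le_trans (_ : Q1 <= _); rewrite ?le_max ?lexx//; lra.
have c0 : 0 < c by lra.
have Z01 : Z `<=` `[0, 1] by move=> z /ZX /X01.
have := exprR_gt0 R r1 n; have := content_split r1 (alpha - e) n Z01.
set q := (r ^ n)%N; set h := fun d => content r (alpha - e) (piece q d Z).
rewrite -/q in Qq qQ *; rewrite -[in X in _ <= _ * X -> _]/(h _) => hsplit q0.
have pq a : 0 < q%:R `^ a :> R by exact: powR_gt0.
have pQ a : 0 < Q `^ a by exact: powR_gt0.
have hS : q%:R `^ (alpha - e) * x <= \sum_(d <- digits q Z) h d.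
  move: (le_trans xZ hsplit); rewrite powRN mulrC ler_pdivlMr//.
  by rewrite mulrC.
pose thr := Q `^ (- (5 * e)) * x.
have thr0 : 0 < thr by rewrite mulr_gt0.
pose D := [seq d <- digits q Z | thr <= h d].
(* The discarded pieces carry at most half of the sum: the 5e in the threshold beats the 2e lost in
   the count. *)
have hlow : \sum_(d <- digits q Z | ~~ (thr <= h d)) h d <= q%:R `^ (alpha - e) * x / 2.
  apply: (@le_trans _ _ (\sum_(d <- digits q Z) thr)).
    rewrite big_mkcond; apply: ler_sum => d _; case: ifP => [|_]; last exact: ltW.
    by rewrite -ltNge => /ltW.
  rewrite big_const_seq count_predT iter_addr addr0 -[_ *+ _]mulr_natl.
  apply: (@le_trans _ _ (C * q%:R `^ (alpha + e) * thr)).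
    rewrite ler_pM2r//; apply: le_trans (hC n); rewrite ler_nat.
    exact: size_digits_sub.
  have -> : alpha + e = (alpha - e) + 2 * e by ring.
  rewrite powRD; last by rewrite (gt_eqF q0) implybT.
  have : q%:R `^ (2 * e) <= (c * Q) `^ (2 * e).
    have cQ0 : 0 < c * Q by exact: mulr_gt0.
    by rewrite ge0_ler_powR ?nnegrE ?(ltW cQ0) ?(ltW q0)//; lra.
  rewrite powRM ?(ltW c0) ?(ltW Q0)// => hq2.
  have thrE : Q `^ (2 * e) * thr * Q `^ (3 * e) = x.
    rewrite /thr mulrAC mulrA -powRD; last by rewrite (gt_eqF Q0) implybT.
    rewrite -powRD; last by rewrite (gt_eqF Q0) implybT.
    by rewrite (_ : _ + _ = 0) ?powRr0 ?mul1r//; ring.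
  rewrite (_ : _ * thr = q%:R `^ (alpha - e) * (C * q%:R `^ (2 * e) * thr)); last by ring.
  rewrite -[leRHS]mulrA ler_pM2l//.
  apply: (@le_trans _ _ (C * (c `^ (2 * e) * Q `^ (2 * e)) * thr)).
    by rewrite ler_pM2r// ler_pM2l.
  rewrite ler_pdivlMr// -[leRHS]thrE.
  rewrite (_ : _ * thr * 2 = Q `^ (2 * e) * thr * (2 * (C * c `^ (2 * e)))); last by ring.
  by rewrite ler_pM2l// mulr_gt0.
have hhigh : q%:R `^ (alpha - e) * x / 2 <= \sum_(d <- D) h d.
  move: hS; rewrite (bigID (fun d => thr <= h d)) /= -big_filter -/D; lra.
have Dpos : 0 < \sum_(d <- D) h d by apply: lt_le_trans hhigh; rewrite divr_gt0// mulr_gt0.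
exists D; split.
- by rewrite filter_uniq// digits_uniq.
- by move: Dpos; rewrite lt0n; case: eqP => // /size0nil ->; rewrite big_nil ltxx.
- by move=> d; rewrite mem_filter => /andP[].
- by move=> d; rewrite mem_filter => /andP[].
have [[d dD hd]|nopoor] := pselect (exists2 d, d \in D & Q `^ kappa * x <= h d).
  by left; exists d.
right.
(* If no piece has content above Q^kappa x, half of the sum must be spread over many pieces. *)
have : \sum_(d <- D) h d <= (size D)%:R * (Q `^ kappa * x).
  apply: (@le_trans _ _ (\sum_(d <- D) (Q `^ kappa * x))).
    rewrite big_seq [leRHS]big_seq; apply: ler_sum => d dD.
    by rewrite leNgt; apply/negP => /ltW lt; apply: nopoor; exists d.
  by rewrite big_const_seq count_predT iter_addr addr0 -[_ *+ _]mulr_natl.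
move=> /(le_trans hhigh).
rewrite mulrAC mulrA ler_pM2r// => hsz.
have pc a : 0 < c `^ a by exact: powR_gt0.
have hq : Q `^ alpha * Q `^ (- e) <= c `^ (alpha + e) * q%:R `^ (alpha - e).
  have E : c `^ (alpha + e) = c `^ alpha * c `^ e by rewrite powRD// (gt_eqF c0) implybT.
  have -> : q%:R `^ (alpha - e) = q%:R `^ alpha * q%:R `^ (- e) :> R.
    by rewrite powRD// (gt_eqF q0) implybT.
  have h1 : Q `^ alpha <= c `^ alpha * q%:R `^ alpha.
    rewrite -powRM ?ler0n ?(ltW c0)// ge0_ler_powR ?nnegrE ?(ltW Q0)//.
      by rewrite mulr_ge0 ?ler0n ?(ltW c0).
    by move: Qq; rewrite ler_pdivrMr// mulrC.
  have h2 : Q `^ (- e) <= c `^ e * q%:R `^ (- e).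
    rewrite !powRN ler_pdivlMr// mulrC ler_pdivrMr//.
    rewrite -powRM ?ler0n ?(ltW c0) ?(ltW Q0)// ge0_ler_powR ?nnegrE ?(ltW e0)//.
    by rewrite mulr_ge0// ?(ltW c0) ?(ltW Q0).
  rewrite E mulrACA; apply: ler_pM => //; exact: ltW.
rewrite -(ler_pM2r (pQ kappa)); apply: le_trans hsz.
rewrite -powRD; last by rewrite (gt_eqF Q0) implybT.
rewrite (_ : _ + _ = alpha - e - e); last by ring.
rewrite powRD; last by rewrite (gt_eqF Q0) implybT.
have -> : Q `^ (alpha - e) = Q `^ alpha * Q `^ (- e).
  by rewrite powRD// (gt_eqF Q0) implybT.
rewrite [X in _ * X]powRN ler_pdivrMr//; apply: le_trans hq _.
rewrite mulrAC -mulrA mulrC ler_pM2l//; lra.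
Qed.

End Counting.

(** * Energy of projections *)

Lemma natr_count (R : pzSemiRingType) (T : Type) (a : pred T) (s : seq T) :
  (count a s)%:R = \sum_(x <- s) (a x)%:R :> R.
Proof.
elim: s => [|x s IH]; first by rewrite big_nil.
by rewrite big_cons /= natrD IH.
Qed.

(** In units of 1/q, the place to which the product of the cells indexed by [p] projects once the
    slope has been rescaled. *)
Definition proj (R : realType) (t : R) (p : nat * nat) : R := p.1%:R + t * p.2%:R.

(* Every subset of [P] inherits the bound on the energy of [P], so the set of
   bad slopes does not depend on the subset. *)
Definition energy (R : realType) (P : seq (nat * nat)) (C t : R) : R :=
  \sum_(p <- P) \sum_(p' <- P) (`|proj t p - proj t p'| <= C)%R%:R.

Section Energy.
Variable R : realType.
Variables (A B : seq nat) (S L : nat) (C C1 C2 C3 b s tau g : R) (t : nat -> R).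
Hypothesis C_ge1 : 1 <= C.
Hypothesis C1_gt0 : 0 < C1.
Hypothesis C2_gt0 : 0 < C2.
Hypothesis C3_gt0 : 0 < C3.
Hypothesis b_gt0 : 0 < b.
Hypothesis s_ge0 : 0 <= s.
Hypothesis tau_ge0 : 0 <= tau.
Hypothesis g_le1 : g <= 1.
Hypothesis g_le : g <= s + tau.
Hypothesis S_gt0 : (0 < S)%N.
Hypothesis B_le : {in B, forall j, (j <= S)%N}.
Hypothesis countA : forall u D, 1 <= D ->
  (count (fun i => `|i%:R - u| <= D) A)%:R <= C1 * D `^ s.
Hypothesis countB : forall u D, 1 <= D ->
  (count (fun j => `|j%:R - u| <= D) B)%:R <= C2 * D `^ tau.
Hypothesis t_le : forall n, `|t n| <= b.
Hypothesis transversal : forall u v, 1 <= v <= S%:R ->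
  (count (fun n => `|u + t n * v| <= C) (iota 0 L))%:R <= C3 * L%:R / v.

Let K := (trunc_log 2 S).+1.
Let P := [seq (i, j) | i <- A, j <- B].

(** Sort by the dyadic size 2^k of the gap between j and j'. Transversality makes near projections
    occur for a proportion at most C3 / 2^k of the slopes, and a single occurrence forces the gap
    between i and i' to be at most (C + b) 2^(k+1). The first term accounts for j = j', where the
    slope has no effect. *)
Let pair_bound (i j i' j' : nat) : j \in B -> j' \in B ->
  \sum_(n <- iota 0 L) (`|proj (t n) (i, j) - proj (t n) (i', j')| <= C)%R%:R <=
  L%:R * ((`|i'%:R - i%:R : R| <= C)%R%:R * (`|j'%:R - j%:R : R| <= 1)%R%:R) +
  \sum_(k < K) (C3 * L%:R / 2 ^+ k) *
    ((`|i'%:R - i%:R : R| <= (C + b) * 2 ^+ k.+1)%R%:R *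
     (`|j'%:R - j%:R : R| <= 2 ^+ k.+1)%R%:R).
Proof.
move=> jB j'B; rewrite -natr_count.
have L0 : (0 : R) <= L%:R by [].
have term0 k : 0 <= (C3 * L%:R / 2 ^+ k) *
    ((`|i'%:R - i%:R : R| <= (C + b) * 2 ^+ k.+1)%R%:R *
     (`|j'%:R - j%:R : R| <= 2 ^+ k.+1)%R%:R).
  by rewrite !mulr_ge0 ?invr_ge0 ?exprn_ge0 ?(ltW C3_gt0).
have sum0 : 0 <= \sum_(k < K) (C3 * L%:R / 2 ^+ k) *
    ((`|i'%:R - i%:R : R| <= (C + b) * 2 ^+ k.+1)%R%:R *
     (`|j'%:R - j%:R : R| <= 2 ^+ k.+1)%R%:R) by apply: sumr_ge0.
pose a n := `|proj (t n) (i, j) - proj (t n) (i', j')| <= C.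
have [/hasP[n _]|] := boolP (has a (iota 0 L)); last first.
  rewrite has_count -leqNgt leqn0 => /eqP; rewrite /a => ->.
  by rewrite addr_ge0// !mulr_ge0.
rewrite /a /proj /= => hn.
have [jj|jj] := eqVneq j j'.
  apply: (@le_trans _ _ L%:R).
    by rewrite ler_nat (leq_trans (count_size _ _))// size_iota.
  subst j'; move: hn; rewrite opprD addrACA subrr addr0 distrC => ->.
  rewrite subrr normr0 ler01 /= !mulr1 lerDl; apply: sumr_ge0 => k _.
  by have := term0 k; rewrite subrr normr0.
pose v := `|j%:R - j'%:R : R|; pose v' := (if (j <= j')%N then (j' - j) else (j - j'))%N.
have vE : v = v'%:R.
  rewrite /v /v'; case: leqP => h; first by rewrite distrC -natrB// normr_nat.
  by rewrite -natrB ?normr_nat// ltnW.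
have v'0 : (0 < v')%N by rewrite /v'; case: (leqP j j') => h; rewrite subn_gt0// ltn_neqAle jj.
have v'S : (v' <= S)%N by rewrite /v'; case: (leqP j j') => _; rewrite (leq_trans (leq_subr _ _))// B_le.
have v1 : 1 <= v <= S%:R by rewrite vE ler1n v'0 ler_nat.
pose k := trunc_log 2 v'.
have kK : (k < K)%N by rewrite ltnS leq_trunc_log.
have kv : 2 ^+ k <= v by rewrite vE -natrX ler_nat trunc_logP.
have vk : v <= 2 ^+ k.+1 by rewrite vE -natrX ler_nat ltnW// trunc_log_ltn.
have hj : `|j'%:R - j%:R : R| <= 2 ^+ k.+1 by rewrite distrC.
have hi : `|i'%:R - i%:R : R| <= (C + b) * 2 ^+ k.+1.
  have e1 : (1 : R) <= 2 ^+ k.+1 by rewrite exprn_ege1// ler1n.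
  have -> : i'%:R - i%:R = t n * (j%:R - j'%:R) -
     ((i%:R + t n * j%:R) - (i'%:R + t n * j'%:R)) by ring.
  apply: (le_trans (ler_normB _ _)); rewrite mulrDl addrC lerD//.
    by apply: (le_trans hn); rewrite ler_peMr// (le_trans _ C_ge1).
  by rewrite normrM ler_pM.
rewrite (bigD1 (Ordinal kK)) //= hi hj !mulr1.
apply: (@le_trans _ _ (C3 * L%:R / 2 ^+ k)); last first.
  rewrite addrCA lerDl addr_ge0// ?mulr_ge0//.
  by apply: sumr_ge0 => l _; exact: term0.
apply: (@le_trans _ _ (C3 * L%:R / v)); last first.
  rewrite ler_wpM2l ?mulr_ge0 ?(ltW C3_gt0)// lef_pV2// posrE ?exprn_gt0//.
  by have /andP[] := v1; lra.
(* Transversality is stated for positive [v], so the difference is negated when j < j'. *)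
have [jlt|jge] := ltP (j%:R - j'%:R : R) 0.
  apply: le_trans (transversal (i'%:R - i%:R) v1).
  rewrite le_eqVlt; apply/orP; left; apply/eqP; congr (_ %:R); apply: eq_count => m.
  by rewrite /a /proj /= /v (ltr0_norm jlt) -normrN; congr (`|_| <= _); ring.
apply: le_trans (transversal (i%:R - i'%:R) v1).
rewrite le_eqVlt; apply/orP; left; apply/eqP; congr (_ %:R); apply: eq_count => m.
by rewrite /a /proj /= /v (ger0_norm jge); congr (`|_| <= _); ring.
Qed.

(* Discrete Marstrand theorem: the integral over the slope is replaced by a
   Birkhoff sum along the orbit [t]. *)
Lemma energy_average :
  \sum_(n <- iota 0 L) energy P C (t n) <=
  C1 * C2 * (C `^ s + (C + b) `^ s * 2 `^ (s + tau) * C3) *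
    L%:R * (size A)%:R * (size B)%:R * K%:R * S%:R `^ (s + tau - g).
Proof.
have hC := C_ge1; have hb := b_gt0; have hs := s_ge0; have ht := tau_ge0.
have hg := g_le1; have hg' := g_le.
set C4 := C1 * C2 * _; set M := S%:R `^ _.
have S1 : 1 <= S%:R :> R by rewrite ler1n.
have M1 : 1 <= M.
  by rewrite -[leLHS](powRr0 (S%:R : R)) ler_powR// subr_ge0.
have L0 : (0 : R) <= L%:R by [].
have K1 : (1 : R) <= K%:R by rewrite ler1n.
rewrite exchange_big /=.
under eq_bigr do rewrite exchange_big /=.
rewrite [leRHS](_ : _ = \sum_(p <- P) (C4 * L%:R * K%:R * M)); last first.
  rewrite big_const_seq count_predT iter_addr addr0 -[_ *+ size P]mulr_natl.
  by rewrite /P size_allpairs natrM; ring.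
rewrite big_seq [leRHS]big_seq; apply: ler_sum => -[i j] /allpairsP[[i0 j0] /= [_ jB [-> ->]]].
move: {i j} i0 j0 jB => i j jB.
pose F i' j' : R := L%:R * ((`|i'%:R - i%:R : R| <= C)%R%:R * (`|j'%:R - j%:R : R| <= 1)%R%:R) +
  \sum_(k < K) (C3 * L%:R / 2 ^+ k) *
    ((`|i'%:R - i%:R : R| <= (C + b) * 2 ^+ k.+1)%R%:R * (`|j'%:R - j%:R : R| <= 2 ^+ k.+1)%R%:R).
apply: (@le_trans _ _ (\sum_(p' <- P) F p'.1 p'.2)).
  rewrite big_seq [leRHS]big_seq; apply: ler_sum => -[i' j'] /allpairsP[[i0 j0] /= [_ j'B [-> ->]]].
  exact: pair_bound.
(* At each dyadic scale the sum over [p'] factors into a count in [A] and a count in [B]. *)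
have prodE (I J : nat -> R) : \sum_(p' <- P) I p'.1 * J p'.2 =
    (\sum_(i' <- A) I i') * (\sum_(j' <- B) J j').
  by rewrite big_allpairs_dep /= big_distrlr.
rewrite /F big_split /= -mulr_sumr exchange_big /=.
rewrite (prodE (fun i' => (`|i'%:R - i%:R : R| <= C)%R%:R)
  (fun j' => (`|j'%:R - j%:R : R| <= 1)%R%:R)) -!natr_count.
under eq_bigr => k _.
  rewrite -mulr_sumr (prodE (fun i' => (`|i'%:R - i%:R : R| <= (C + b) * 2 ^+ k.+1)%R%:R)
    (fun j' => (`|j'%:R - j%:R : R| <= 2 ^+ k.+1)%R%:R)) -!natr_count.
  over.
rewrite /=.
have h0 : L%:R * ((count (fun i' => `|i'%:R - i%:R : R| <= C) A)%:R *
    (count (fun j' => `|j'%:R - j%:R : R| <= 1) B)%:R) <=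
    L%:R * (C1 * C `^ s * C2) * (K%:R * M).
  apply: (@le_trans _ _ (L%:R * (C1 * C `^ s * C2))).
    rewrite ler_wpM2l// ler_pM//; first exact: countA.
    by have := @countB j%:R 1 (lexx _); rewrite powR1 mulr1.
  by rewrite ler_peMr ?mulr_ge0 ?powR_ge0 ?(ltW C1_gt0) ?(ltW C2_gt0)// mulr_ege1.
have hk (k : 'I_K) : (C3 * L%:R / 2 ^+ k) *
    ((count (fun i' => `|i'%:R - i%:R : R| <= (C + b) * 2 ^+ k.+1) A)%:R *
     (count (fun j' => `|j'%:R - j%:R : R| <= 2 ^+ k.+1) B)%:R) <=
    L%:R * (C1 * C2 * ((C + b) `^ s * 2 `^ (s + tau) * C3)) * M.
  have e1 : (1 : R) <= 2 ^+ k.+1 by rewrite exprn_ege1// ler1n.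
  have Y1 : (1 : R) <= 2 ^+ k by rewrite exprn_ege1// ler1n.
  have Cb : 1 <= C + b by lra.
  set Y : R := 2 ^+ k in Y1 *.
  have YS : Y <= S%:R.
    rewrite /Y -natrX ler_nat; have := ltn_ord k; rewrite ltnS => /(@leq_pexp2l 2 _ _ isT).
    by move=> /leq_trans; apply; exact: trunc_logP.
  rewrite exprS -/Y in e1 *.
  apply: (@le_trans _ _ ((C3 * L%:R / Y) * (C1 * ((C + b) * (2 * Y)) `^ s * (C2 * (2 * Y) `^ tau)))).
    rewrite ler_wpM2l ?mulr_ge0 ?invr_ge0 ?(ltW C3_gt0)//; first by lra.
    by rewrite ler_pM//; [apply: countA; rewrite mulr_ege1|exact: countB].
  have Y0 : 0 < Y by lra.
  rewrite powRM; [|lra..].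
  rewrite [leLHS](_ : _ = L%:R * (C1 * C2 *
    ((C + b) `^ s * ((2 * Y) `^ s * (2 * Y) `^ tau / Y) * C3))); last by ring.
  have Y2 : 0 < 2 * Y by lra.
  rewrite -powRD; last by rewrite (gt_eqF Y2) implybT.
  rewrite powRM; [|lra..].
  (* Since [g] is at most both 1 and s + tau, Y^(s + tau - 1) <= S^(s + tau - g); this is where the
     minimum with 1 comes from. *)
  have hY : Y `^ (s + tau) / Y <= M.
    rewrite -{2}(powRr1 (ltW Y0)) -powRN -powRD; last by rewrite (gt_eqF Y0) implybT.
    apply: (@le_trans _ _ (Y `^ (s + tau - g))); first by rewrite ler_powR//; lra.
    by rewrite ge0_ler_powR ?nnegrE//; lra.
  rewrite [leLHS](_ : _ = L%:R * (C1 * C2 * ((C + b) `^ s * 2 `^ (s + tau) * C3)) *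
     (Y `^ (s + tau) / Y)); last by ring.
  rewrite ler_wpM2l// !mulr_ge0 ?powR_ge0//; exact: ltW.
apply: (le_trans (lerD h0 (ler_sum _ (fun k _ => hk k)))).
rewrite sumr_const card_ord -[_ *+ K]mulr_natl /C4.
by rewrite le_eqVlt; apply/orP; left; apply/eqP; ring.
Qed.

End Energy.

Lemma irrational_natmul (R : realType) (theta : R) n : (0 < n)%N ->
  irrational theta -> irrational (n%:R * theta).
Proof.
move=> n0 irr [x _ xE]; apply: irr; exists (x / n%:R) => //.
have nz : (n%:R : R) != 0 by rewrite pnatr_eq0 -lt0n.
by rewrite fmorph_div /= ratr_nat xE mulrC mulKf.
Qed.

(** * Orbits of slopes *)

Section Penalty.
Variable R : realType.
Variables (next_slope : R -> R) (bad : pred R) (e : R).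

(* The largest excess, over the first m <= K steps of the orbit of t, of the
   number of bad slopes over the allowed e * m. *)
Fixpoint penalty (K : nat) (t : R) : R :=
  if K is K'.+1 then Num.max 0 ((bad t)%:R - e + penalty K' (next_slope t)) else 0.

Lemma penalty_ge0 K t : 0 <= penalty K t.
Proof. by case: K => [|K] //=; rewrite le_max lexx. Qed.

Lemma penaltyS K t : (bad t)%:R - e + penalty K (next_slope t) <= penalty K.+1 t.
Proof. by rewrite /= le_max lexx orbT. Qed.

Let excess m t : R := (count (fun n => bad (iter n next_slope t)) (iota 0 m))%:R - e * m%:R.

Let excessD m n t : excess (m + n) t = excess m t + excess n (iter m next_slope t).
Proof.
rewrite /excess iotaD count_cat natrD add0n natrD.
rewrite [X in _ + X%:R](_ : _ = count (fun k => bad (iter k next_slope (iter m next_slope t))) (iota 0 n)).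
  by ring.
rewrite -[in LHS](addn0 m) iotaDl count_map; apply: eq_count => k /=.
by rewrite addnC iterD.
Qed.

(** The excess adds up along the orbit and is at most 0 over every block of L steps, so a run
    attaining the maximum can be cut to fewer than L steps. The bound is the same for all [K]. *)
Lemma penalty_le (W : set R) (L K : nat) t : 0 <= e -> (0 < L)%N ->
  (forall u, W u -> W (next_slope u)) ->
  (forall u, W u -> (count (fun n => bad (iter n next_slope u)) (iota 0 L))%:R <= e * L%:R) ->
  W t -> penalty K t <= L%:R.
Proof.
move=> e0 L0 Wn hW Wt.
have Wi m u : W u -> W (iter m next_slope u) by move=> Wu; elim: m => //= m; exact: Wn.
have [m ->] : exists m, penalty K t = excess m t.
  elim: K t {Wt} => [|K IH] t; first by exists 0%N; rewrite /excess /= mulr0 subr0.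
  have [m hm] := IH (next_slope t).
  rewrite /= maxEle; case: ifP => _; last by exists 0%N; rewrite /excess /= mulr0 subr0.
  exists m.+1; rewrite -[m.+1]add1n excessD hm /excess /= addn0 mulr1; ring.
elim/ltn_ind: m t Wt => m IH t Wt; have [mL|Lm] := ltnP m L.
  apply: (@le_trans _ _ m%:R); last by rewrite ler_nat ltnW.
  rewrite lerBlDr (@le_trans _ _ m%:R) ?lerDl ?mulr_ge0//.
  by rewrite ler_nat (leq_trans (count_size _ _))// size_iota.
rewrite -(subnKC Lm) excessD.
have h1 : excess L t <= 0 by rewrite subr_le0; exact: hW.
have mL : (m - L < m)%N by rewrite ltn_subrL L0 (leq_trans L0).
have h2 := IH _ mL _ (Wi L _ Wt).
lra.
Qed.

End Penalty.

Section Orbit.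
Variable R : realType.
Variables (q s M0 : nat) (a b : R).
Hypothesis s1 : (1 < s)%N.
Hypothesis a0 : 0 < a.
Hypothesis ab : s%:R * a <= b.
Hypothesis qlo : (s ^ M0 <= q)%N.
Hypothesis qhi : (q < s ^ M0.+1)%N.

(* Zooming by q in X and by s^n in Y multiplies the slope by q / s^n; the
   exponent n is M0 or M0 + 1, chosen so that the slope stays in [a, b]. *)
Definition step_exponent (t : R) : nat :=
  if t * q%:R / (s ^ M0)%:R <= b then M0 else M0.+1.

Definition next_slope (t : R) : R := t * q%:R / (s ^ step_exponent t)%:R.

Let sM n : 0 < (s ^ n)%:R :> R.
Proof. exact: exprR_gt0. Qed.

(** As [b] is at least [s * a], the extra division by s, made only above [b], cannot lead below
    [a]. *)
Lemma next_window t : a <= t <= b -> a <= next_slope t <= b.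
Proof.
have a_gt0 := a0; have sab := ab.
move=> /andP[ta tb]; rewrite /next_slope /step_exponent; case: ifP => [h|/negbT].
  rewrite h andbT; apply: (le_trans ta).
  by rewrite ler_pdivlMr// ler_pM2l ?ler_nat//; lra.
rewrite -ltNge => h; have s0 : 0 < s%:R :> R by rewrite ltr0n ltnW.
apply/andP; split.
  rewrite expnS natrM invfM mulrCA mulrC ler_pdivlMr// mulrC.
  by apply: (le_trans ab); rewrite ltW.
have qs : q%:R <= (s ^ M0.+1)%:R :> R by rewrite ler_nat; exact: ltnW qhi.
by apply: le_trans tb; rewrite ler_pdivrMr// ler_pM2l//; lra.
Qed.

Lemma iter_next_window t n : a <= t <= b -> a <= iter n next_slope t <= b.
Proof. by move=> h; elim: n => //= n; exact: next_window. Qed.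

(** Divided by [ln s], this is a rotation by [ln q / ln s] up to an integer. *)
Lemma ln_next t : 0 < t -> ln (next_slope t) = ln t + ln q%:R - (step_exponent t)%:R * ln (s%:R : R).
Proof.
move=> t0; have q0 : 0 < q%:R :> R.
  by rewrite ltr0n (leq_trans _ qlo)// expn_gt0 ltnW.
rewrite /next_slope ln_div ?posrE ?mulr_gt0// lnM ?posrE// natrX lnXn ?ltr0n ?(ltnW s1)//.
by rewrite mulr_natl.
Qed.

Lemma ln_lip x y : a <= x -> a <= y -> `|ln x - ln y| <= `|x - y| / a.
Proof.
have a_gt0 := a0.
wlog xy : x y / x <= y => [H ax ay|ax ay].
  have [xy|/ltW yx] := leP x y; first exact: H.
  by rewrite distrC [`|x - y|]distrC; exact: H.
have x0 : 0 < x by lra.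
have y0 : 0 < y by lra.
rewrite distrC ger0_norm; last by rewrite subr_ge0 ler_ln ?posrE.
rewrite distrC ger0_norm ?subr_ge0//.
have h : ln y - ln x <= (y - x) / x.
  rewrite -ln_div ?posrE// (_ : y / x = 1 + (y - x) / x).
    apply: le_ln1Dx; rewrite (@lt_le_trans _ _ 0)// divr_ge0 ?subr_ge0//; lra.
  by field; rewrite gt_eqF.
by apply: (le_trans h); rewrite ler_wpM2l ?subr_ge0// lef_pV2 ?posrE.
Qed.

(** Slopes counted for the same [u] and [v] differ by at most 2C/v, so their logarithms lie in a
    short interval, which the rotation visits rarely. The orbit itself is positive; [sg] carries the
    sign of the slope. *)
Lemma orbit_transversal (C : R) (S : nat) : (0 < S)%N -> 0 < C ->
  irrational (ln q%:R / ln s%:R : R) ->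
  exists L, (0 < L)%N /\ forall (sg t : R), `|sg| = 1 -> a <= t <= b ->
    forall u v, 1 <= v <= S%:R ->
    (count (fun n => `|u + sg * iter n next_slope t * v| <= C) (iota 0 L))%:R <=
    (30 * C / (a * ln s%:R)) * L%:R / v.
Proof.
have a_gt0 := a0.
move=> S0 C0 irr.
have ls : 0 < ln s%:R :> R by rewrite ln_gt0// ltr1n.
have als : 0 < a * ln s%:R by rewrite mulr_gt0.
have SR : 0 < S%:R :> R by rewrite ltr0n.
(* The shortest interval belongs to [v = S], so [L] can be chosen before [v]. *)
have [L [L0 hL]] := @rotation_count R _ (2 * C / (a * ln s%:R) / S%:R) irr ltac:(by rewrite !divr_gt0// mulr_gt0).
exists L; split => // sg t sg1 hW u v /andP[v1 vS].
have v0 : 0 < v by lra.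
pose x n := ln (iter n next_slope t) / ln s%:R.
rewrite [leRHS](_ : _ = 15 * (2 * C / (a * ln s%:R) / v) * L%:R); last by ring.
apply: (hL x (fun n => `|u + sg * iter n next_slope t * v| <= C)).
- move=> n; exists (- (step_exponent (iter n next_slope t))%:Z).
  have /andP[an _] := iter_next_window n hW.
  rewrite /x iterS ln_next; last by lra.
  by rewrite mulrNz -pmulrn; field; rewrite gt_eqF.
- rewrite ler_wpM2l// ?lef_pV2 ?posrE//.
  by rewrite divr_ge0// ltW// mulr_gt0.
move=> m n hm hn.
have /andP[am _] := iter_next_window m hW.
have /andP[an _] := iter_next_window n hW.
rewrite /x -mulrBl normrM [`|_^-1|]gtr0_norm ?invr_gt0// ler_pdivrMr//.
apply: (le_trans (ln_lip am an)); rewrite ler_pdivrMr//.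
rewrite [leRHS](_ : _ = 2 * C / v); last by field; rewrite !gt_eqF.
rewrite ler_pdivlMr//.
have -> : `|iter m next_slope t - iter n next_slope t| * v =
  `|(u + sg * iter m next_slope t * v) - (u + sg * iter n next_slope t * v)|.
  rewrite (_ : _ - (_ + _) = sg * ((iter m next_slope t - iter n next_slope t) * v)); last by ring.
  by rewrite normrM sg1 mul1r normrM (gtr0_norm v0).
apply: (le_trans (ler_normB _ _)); lra.
Qed.

End Orbit.

(** * Frequency of bad slopes *)

Lemma trunc_log_bound (R : realType) (e : R) : 0 < e ->
  exists2 C : R, 0 < C & forall S, (0 < S)%N ->
    (trunc_log 2 S).+1%:R <= C * S%:R `^ e.
Proof.
move=> e0; pose d : R := 2 `^ e - 1.
have d0 : 0 < d.
  have e1 : 1 `^ e = 1 :> R by rewrite powR1.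
  by rewrite subr_gt0 -[ltLHS]e1 gt0_ltr_powR ?nnegrE//; lra.
have dV : 0 < d^-1 by rewrite invr_gt0.
exists (1 + d^-1); first by lra.
move=> S S0; set k := trunc_log 2 S.
apply: (@le_trans _ _ ((1 + d^-1) * (2 `^ e) ^+ k)).
  elim: k => [|k IH]; first by rewrite expr0 mulr1; lra.
  rewrite exprS -natr1.
  have h1 : 1 <= (2 `^ e) ^+ k.
    by rewrite exprn_ege1//; move: d0; rewrite /d subr_gt0 => /ltW.
  have -> : (1 + d^-1) * (2 `^ e * (2 `^ e) ^+ k) =
      (1 + d^-1) * (2 `^ e) ^+ k + (d + 1) * (2 `^ e) ^+ k.
    rewrite (_ : 2 `^ e = d + 1); last by rewrite /d subrK.
    by field; rewrite gt_eqF.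
  have : 1 <= (d + 1) * (2 `^ e) ^+ k by apply: mulr_ege1 => //; lra.
  lra.
rewrite ler_wpM2l//; first by lra.
rewrite -powR_mulrn ?powR_ge0// powRAC powR_mulrn//.
rewrite ge0_ler_powR ?nnegrE ?exprn_ge0 ?ler0n ?(ltW e0)//.
by rewrite -natrX ler_nat trunc_logP.
Qed.

Definition pairs (R : realType) (q q' : nat) (X Y : set R) : seq (nat * nat) :=
  [seq (i, j) | i <- digits q X, j <- digits q' Y].

Lemma markov_count (R : realType) (f : nat -> R) (thr : R) (s : seq nat) :
  (forall n, 0 <= f n) -> 0 <= thr ->
  (count (fun n => thr < f n) s)%:R * thr <= \sum_(n <- s) f n.
Proof.
move=> f0 thr0; rewrite natr_count mulr_suml; apply: ler_sum => n _.
by case: ltP => [/ltW|_]; rewrite ?mul1r ?mul0r.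
Qed.

Lemma energy_ge0 (R : realType) P (C t : R) : 0 <= energy P C t.
Proof. by apply: sumr_ge0 => p _; apply: sumr_ge0. Qed.

Lemma ler_prod4 (R : numDomainType) (k x1 x2 x3 x4 y1 y2 y3 y4 : R) : 0 <= k ->
  0 <= x1 -> 0 <= x2 -> 0 <= x3 -> 0 <= x4 ->
  x1 <= y1 -> x2 <= y2 -> x3 <= y3 -> x4 <= y4 ->
  k * x1 * x2 * x3 * x4 <= k * y1 * y2 * y3 * y4.
Proof. by move=> *; rewrite ?(ler_pM, mulr_ge0). Qed.

Section BadFrequency.
Variables (R : realType) (r s : nat) (X Y : set R).
Variables (alpha beta e g Cx Cy a b : R).

(** About Q^(alpha + beta) pairs spread over Q^g places have energy of exponent 2(alpha + beta) - g;
    the 6e covers the losses in the counts. *)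
Definition bad_threshold (Q : R) : R := Q `^ (2 * (alpha + beta) - g + 6 * e).

(** Both exponents are tested because a step may use either. The distance [b + 2] is the one in
    [touch_near]. *)
Definition bad_slope (q M : nat) (t : R) : bool :=
  (bad_threshold q%:R < energy (pairs q (s ^ M) X Y) (b + 2) t) ||
  (bad_threshold q%:R < energy (pairs q (s ^ M.+1) X Y) (b + 2) t).

(** Markov's inequality for the averaged energy. One e of the 6e in the threshold is left over, and
    Q^e beats the constants and 1/e2; another pays for the logarithmic number of dyadic scales. *)
Lemma bad_frequency (e2 : R) :
  (1 < r)%N -> (1 < s)%N -> piece_closed r X -> piece_closed s Y ->
  0 <= alpha -> 0 <= beta -> 0 < e -> g <= 1 -> g <= alpha + beta ->
  0 < Cx -> 0 < Cy ->
  (forall k, (size (digits (r ^ k) X))%:R <= Cx * (r ^ k)%:R `^ (alpha + e)) ->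
  (forall k, (size (digits (s ^ k) Y))%:R <= Cy * (s ^ k)%:R `^ (beta + e)) ->
  0 < a -> s%:R * a <= b -> irrational (ln r%:R / ln s%:R : R) -> 0 < e2 ->
  exists2 Q0 : R, 1 <= Q0 & forall N M, Q0 <= (r ^ N)%:R ->
    (s ^ M <= r ^ N)%N -> (r ^ N < s ^ M.+1)%N ->
    exists L, (0 < L)%N /\ forall sg t, `|sg| = 1 -> a <= t <= b ->
      (count (fun n => bad_slope (r ^ N) M (sg * iter n (next_slope (r ^ N) s M b) t)) (iota 0 L))%:R
        <= e2 * L%:R.
Proof.
move=> r1 s1 Xc Yc al0 be0 e0 g1 gab Cx0 Cy0 hX hY a0 sab irr e20.
have s0R : 1 <= s%:R :> R by rewrite ler1n ltnW.
have b0 : 0 < b by apply: lt_le_trans sab; rewrite mulr_gt0//; lra.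
have ae0 : 0 <= alpha + e by lra.
have be0' : 0 <= beta + e by lra.
have [C1 C10 locX] := local_count r1 Xc ae0 Cx0 hX.
have [C2 C20 locY] := local_count s1 Yc be0' Cy0 hY.
have gs : g <= alpha + e + (beta + e) by lra.
have [Ck Ck0 hCk] := trunc_log_bound e0.
have ls : 0 < ln s%:R :> R by rewrite ln_gt0// ltr1n.
pose C := b + 2; have hC1 : 1 <= C by rewrite /C; lra.
pose C3 := 30 * C / (a * ln s%:R).
have C31 : 0 < C3 by rewrite divr_gt0 ?mulr_gt0// /C; lra.
pose sg0 := alpha + e; pose tau := beta + e.
pose C4 := C1 * C2 * (C `^ sg0 + (C + b) `^ sg0 * 2 `^ (sg0 + tau) * C3).
have C40 : 0 <= C4.
  apply: mulr_ge0; first exact: mulr_ge0 (ltW C10) (ltW C20).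
  apply: addr_ge0; first exact: powR_ge0.
  by apply: mulr_ge0 (ltW C31); exact: mulr_ge0 (powR_ge0 _ _) (powR_ge0 _ _).
(* The power of s comes from replacing [s ^ M'] by its bound [s * q]. *)
pose C5 := C4 * Cx * Cy * Ck * s%:R `^ (beta + e + e + (sg0 + tau - g)).
have [Q1 Q11 hQ1] := @powR_large R (2 * C5 / e2) e e0.
exists (Num.max 2 Q1) => [|N M hN sMlo sMhi]; first by rewrite le_max Q11 orbT.
set q := (r ^ N)%N in hN sMlo sMhi *.
have q2 : 2 <= q%:R :> R by apply: le_trans hN; rewrite le_max lexx.
have qQ1 : Q1 <= q%:R by apply: le_trans hN; rewrite le_max lexx orbT.
have q0 : 0 < q%:R :> R by lra.
have N0 : (0 < N)%N.
  rewrite lt0n; apply/eqP => N00; move: q2; rewrite /q N00 expn0.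
  by rewrite (ler_nat R 2 1).
have irrq : irrational (ln q%:R / ln s%:R : R).
  rewrite /q natrX lnXn ?ltr0n ?(ltnW r1)// -[ln _ *+ N]mulr_natl -mulrA.
  exact: irrational_natmul.
have C0 : 0 < C by exact: lt_le_trans hC1.
have [L [L0 hL]] := @orbit_transversal R q s M a b s1 a0 sab sMlo sMhi C (s ^ M.+1)%N
  (expr_gt0 s1 _) C0 irrq.
exists L; split=> // sg t sg1 tW.
have one M' : (M <= M' <= M.+1)%N ->
  (count (fun n => bad_threshold q%:R < energy (pairs q (s ^ M') X Y) (b + 2)
     (sg * iter n (next_slope q s M b) t)) (iota 0 L))%:R <= e2 / 2 * L%:R.
  move=> /andP[MM' M'M].
  have thr0 : 0 < bad_threshold q%:R by exact: powR_gt0.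
  have S0 := expr_gt0 s1 M'.
  have SR0 : 0 < (s ^ M')%:R :> R by rewrite ltr0n.
  have SsQ : (s ^ M')%:R <= s%:R * q%:R :> R.
    rewrite -natrM ler_nat (leq_trans (_ : _ <= s ^ M.+1)%N)// ?leq_exp2l//.
    by rewrite expnS leq_mul.
  have sq0 : 0 < s%:R * q%:R :> R by rewrite mulr_gt0// ltr0n ltnW.
  have avg := @energy_average R (digits q X) (digits (s ^ M') Y) (s ^ M') L C C1 C2 C3 b
    sg0 tau g (fun n => sg * iter n (next_slope q s M b) t).
  have {}avg := avg hC1 C10 C20 C31 b0 ae0 be0' g1 gs S0.
  have := markov_count (iota 0 L) (fun n => energy_ge0 (pairs q (s ^ M') X Y) (b + 2)
     (sg * iter n (next_slope q s M b) t)) (ltW thr0).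
  rewrite -ler_pdivlMr// => /le_trans; apply.
  rewrite ler_pdivrMr//.
  apply: le_trans (avg _ _ _ _ _) _.
  - move=> j; rewrite mem_filter mem_iota => /andP[_].
    by rewrite leq0n add0n ltnS.
  - by move=> u D D1; exact: locX.
  - by move=> u D D1; exact: locY.
  - move=> n; rewrite normrM sg1 mul1r.
    have /andP[i1 i2] := @iter_next_window R q s M a b s1 a0 sab sMlo sMhi t n tW.
    by rewrite gtr0_norm//; exact: lt_le_trans i1.
  - move=> u v /andP[v1 vS]; apply: hL => //; rewrite v1/=; apply: (le_trans vS).
    by rewrite ler_nat leq_exp2l.
  rewrite -/C4.
  have pS x : 0 <= x -> (s ^ M')%:R `^ x <= s%:R `^ x * q%:R `^ x :> R.
    by move=> x0; rewrite -powRM ?ler0n// ge0_ler_powR ?nnegrE ?ler0n//.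
  have hA := hX N; rewrite -/q in hA.
  have hB := le_trans (hY M') (ler_wpM2l (ltW Cy0) (pS (beta + e) be0')).
  have hK := le_trans (hCk _ S0) (ler_wpM2l (ltW Ck0) (pS e (ltW e0))).
  have hS := pS (sg0 + tau - g) ltac:(by rewrite subr_ge0).
  have CL0 : 0 <= C4 * L%:R by rewrite mulr_ge0.
  apply: (@le_trans _ _ (C4 * L%:R * (Cx * q%:R `^ (alpha + e)) *
    (Cy * (s%:R `^ (beta + e) * q%:R `^ (beta + e))) *
    (Ck * (s%:R `^ e * q%:R `^ e)) *
    (s%:R `^ (sg0 + tau - g) * q%:R `^ (sg0 + tau - g)))).
    by apply: ler_prod4; rewrite ?powR_ge0.
  have q0' := gt_eqF q0; have sR0 : 0 < s%:R :> R by exact: lt_le_trans s0R.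
  have C5E : C4 * Cx * Cy * Ck * (s%:R `^ (beta + e) * s%:R `^ e * s%:R `^ (sg0 + tau - g)) = C5.
    by rewrite /C5 !powRD// (gt_eqF sR0) implybT.
  have qE : q%:R `^ (alpha + e) * q%:R `^ (beta + e) * q%:R `^ e * q%:R `^ (sg0 + tau - g) * q%:R `^ e
      = bad_threshold q%:R.
    rewrite -!powRD ?q0' ?implybT// /bad_threshold; congr (_ `^ _).
    by rewrite /sg0 /tau; ring.
  rewrite -qE.
  rewrite [leLHS](_ : _ = C5 * (L%:R * (q%:R `^ (alpha + e) * q%:R `^ (beta + e) *
    q%:R `^ e * q%:R `^ (sg0 + tau - g)))); last first.
    by rewrite -C5E; ring.
  rewrite [leRHS](_ : _ = (e2 / 2 * q%:R `^ e) * (L%:R * (q%:R `^ (alpha + e) *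
    q%:R `^ (beta + e) * q%:R `^ e * q%:R `^ (sg0 + tau - g)))); last by ring.
  rewrite ler_wpM2r ?mulr_ge0 ?powR_ge0//.
  by have := hQ1 _ qQ1; rewrite ler_pdivrMr// mulrAC ler_pdivlMr// mulrC [X in _ <= X]mulrC.
have hM := one M ltac:(by rewrite leqnn leqnSn).
have hM1 := one M.+1 ltac:(by rewrite leqnn leqnSn).
apply: (@le_trans _ _ (e2 / 2 * L%:R + e2 / 2 * L%:R)); last by rewrite -mulrDl -splitr.
apply: le_trans (lerD hM hM1); rewrite -natrD ler_nat -count_predUI.
rewrite (leq_trans _ (leq_addr _ _))//; exact: sub_count.
Qed.

End BadFrequency.

(** * Energy and the pigeonhole principle *)

Lemma ler_sum_subset (R : numDomainType) (T : eqType) (s s' : seq T) (f : T -> R) :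
  uniq s -> {subset s <= s'} -> (forall x, 0 <= f x) ->
  \sum_(x <- s) f x <= \sum_(x <- s') f x.
Proof.
move=> + + f0; elim: s s' => [|x s IH] s' /=.
  by rewrite big_nil => _ _; apply: sumr_ge0.
move=> /andP[xs us] sub; have xs' : x \in s' by apply: sub; rewrite mem_head.
rewrite big_cons (big_rem x xs') /= lerD2l; apply: IH => // y ys.
have : y \in s' by apply: sub; rewrite inE ys orbT.
rewrite (perm_mem (perm_to_rem xs')) inE => /orP[/eqP yx|//].
by rewrite -yx ys in xs.
Qed.

Lemma energy_subset (R : realType) (P P' : seq (nat * nat)) (C t : R) :
  uniq P' -> {subset P' <= P} -> energy P' C t <= energy P C t.
Proof.
move=> uP' sub; apply: (@le_trans _ _ (\sum_(p <- P') \sum_(p' <- P) (`|proj t p - proj t p'| <= C)%R%:R)).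
  by apply: ler_sum => p _; apply: ler_sum_subset.
by apply: ler_sum_subset => // p; apply: sumr_ge0.
Qed.

(* Each pair carries the weight 1 / (number of pairs with a nearby projection):
   an element touching only pairs with mutually near projections sees total
   weight at most 1, while by Cauchy-Schwarz the total weight is at least
   (size P)^2 / E. *)
Lemma energy_pigeonhole (R : realType) (T : eqType) (P : seq (nat * nat)) (bs : seq T)
    (w : T -> R) (touch : T -> pred (nat * nat)) (C t E F : R) :
  0 <= C -> 0 < E -> 0 <= F -> energy P C t <= E -> (forall i, 0 <= w i) ->
  {in bs, forall i, forall p p', touch i p -> touch i p' ->
     `|proj t p - proj t p'| <= C} ->
  {in P, forall p, F <= \sum_(i <- bs | touch i p) w i} ->
  F * (size P)%:R ^+ 2 <= E * \sum_(i <- bs) w i.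
Proof.
move=> C0 E0 F0 hE w0 hT hF.
pose near p : R := (count (fun p' => `|proj t p - proj t p'| <= C) P)%:R.
have [/size0nil ->|n0] := posnP (size P).
  by rewrite expr0n mulr0 mulr_ge0 ?(ltW E0)// sumr_ge0.
have nR : 0 < (size P)%:R :> R by rewrite ltr0n.
have near1 p : p \in P -> 1 <= near p.
  move=> pP; rewrite ler1n -has_count; apply/hasP; exists p => //.
  by rewrite subrr normr0.
have sumnear : \sum_(p <- P) near p <= E.
  by apply: le_trans hE; apply: ler_sum => p _; rewrite /near natr_count.
(* All pairs touched by [i] are near each other, so each of their [near p] is at least their
   number. *)
have touch1 i : i \in bs -> \sum_(p <- P | touch i p) (near p)^-1 <= 1.
  move=> ib; have [/eqP c0|] := boolP (count (touch i) P == 0)%N.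
    rewrite big_seq_cond big1 ?ler01// => p /andP[pP tp].
    by move: c0 => /eqP; rewrite -leqn0 leqNgt -has_count => /hasP; case; exists p.
  rewrite -lt0n => c0; have cR : 0 < (count (touch i) P)%:R :> R by rewrite ltr0n.
  apply: (@le_trans _ _ (\sum_(p <- P | touch i p) ((count (touch i) P)%:R)^-1)).
    rewrite big_seq_cond [leRHS]big_seq_cond; apply: ler_sum => p /andP[pP tp].
    rewrite lef_pV2 ?posrE// ?(lt_le_trans ltr01 (near1 _ pP))//.
    by rewrite ler_nat; apply: sub_count => p' /= tp'; exact: hT tp tp'.
  by rewrite big_const_seq iter_addr addr0 -[_ *+ count _ _]mulr_natl divff ?gt_eqF.
have invsum : (size P)%:R ^+ 2 / E <= \sum_(p <- P) (near p)^-1.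
  (* Cauchy-Schwarz through convexity: 1/x lies above its tangent 2/m - x/m^2 at [m]. *)
  pose m := E / (size P)%:R; have m0 : 0 < m by rewrite divr_gt0.
  apply: (@le_trans _ _ (\sum_(p <- P) (2 / m - near p / m ^+ 2))).
    have -> : \sum_(p <- P) (2 / m - near p / m ^+ 2) =
        (size P)%:R * (2 / m) - (\sum_(p <- P) near p) / m ^+ 2.
      by rewrite sumrB mulr_suml big_const_seq count_predT iter_addr addr0 [(size P)%:R * _]mulr_natl.
    apply: (@le_trans _ _ ((size P)%:R * (2 / m) - E / m ^+ 2)); last first.
      by rewrite lerD2l lerN2 ler_pM2r// invr_gt0 exprn_gt0.
    rewrite le_eqVlt; apply/orP; left; apply/eqP; rewrite /m; field.
    by rewrite !gt_eqF.
  rewrite big_seq [leRHS]big_seq; apply: ler_sum => p /near1 np.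
  have np0 : 0 < near p by exact: lt_le_trans np.
  rewrite -subr_ge0 (_ : _ - _ = (near p - m) ^+ 2 / (near p * m ^+ 2)).
    by rewrite divr_ge0 ?sqr_ge0// mulr_ge0 ?sqr_ge0// ltW.
  by field; rewrite !gt_eqF.
have key : F * \sum_(p <- P) (near p)^-1 <= \sum_(i <- bs) w i.
  apply: (@le_trans _ _ (\sum_(p <- P) \sum_(i <- bs | touch i p) w i * (near p)^-1)).
    rewrite mulr_sumr big_seq [leRHS]big_seq; apply: ler_sum => p pP.
    by rewrite -mulr_suml ler_wpM2r ?invr_ge0 ?hF.
  under eq_bigr do rewrite big_mkcond.
  rewrite exchange_big /= big_seq [leRHS]big_seq; apply: ler_sum => i ib.
  by rewrite -big_mkcond /= -mulr_sumr ler_piMr// touch1.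
rewrite [E * _]mulrC -ler_pdivrMr// -mulrA.
by apply: le_trans key; rewrite ler_wpM2l.
Qed.

(** * Lower bound for covers by balls *)

Section BallCovers.
Variable R : realType.
Implicit Types (bs : seq (R * R)) (Z V : set R) (t : R).

(* A pair (c, d) stands for the ball of center c and diameter d. *)
Definition ball_cover bs Z V t : Prop := forall z v, Z z -> V v ->
  exists2 p, p \in bs & `|z + t * v - p.1| < p.2 / 2.

Definition volume (gamma : R) bs : R := \sum_(p <- bs) p.2 `^ gamma.

(** Here [t] is the slope after zooming: blown up by q, the ball [p] meets the sum of the two pieces
    placed at [proj t de]. *)
Definition touch (q q' : nat) Z V t (p : R * R) (de : nat * nat) : bool :=
  `[< exists z v, [/\ piece q de.1 Z z, piece q' de.2 V v &
      `|z + t * v + proj t de - q%:R * p.1| < q%:R * p.2 / 2] >].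

(** Two points of the blown-up ball are within 1 of each other, the pieces of Z contribute 1 and
    those of V at most [b]. *)
Lemma touch_near q q' Z V t b p de de' : q%:R * p.2 <= 1 -> `|t| <= b ->
  touch q q' Z V t p de -> touch q q' Z V t p de' ->
  `|proj t de - proj t de'| <= b + 2.
Proof.
move=> qp tb /asboolP[z [v [[/andP[z0 z1] _] [/andP[v0 v1] _] h]]].
move=> /asboolP[z' [v' [[/andP[z'0 z'1] _] [/andP[v'0 v'1] _] h']]].
set x := z + _ + _ - _ in h; set x' := z' + _ + _ - _ in h'.
have -> : proj t de - proj t de' = (x - x') + (z' - z) + t * (v' - v).
  by rewrite /x /x'; ring.
have hv : `|t * (v' - v)| <= b.
  rewrite normrM -[leRHS]mulr1 ler_pM// ler_norml; apply/andP; split; lra.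
have hz : `|z' - z| <= 1 by rewrite ler_norml; apply/andP; split; lra.
have hx : `|x - x'| <= 1 by apply: (le_trans (ler_normB _ _)); lra.
apply: (le_trans (ler_normD _ _)); apply: (@le_trans _ _ (1 + 1 + b)); last by lra.
by rewrite lerD// (le_trans (ler_normD _ _))// lerD.
Qed.

(** The touching balls, blown up by q and translated, cover the sum of the two pieces, and their
    volume grows by [q ^ gamma]. The bound [F] is a hypothesis on covers so that an induction
    hypothesis can supply it. *)
Lemma ball_cover_piece q q' d e Z V t bs gamma F : (0 < q)%N -> (0 < q')%N ->
  {in bs, forall p, 0 <= p.2} -> ball_cover bs Z V t ->
  (forall bs', ball_cover bs' (piece q d Z) (piece q' e V) (t * q%:R / q'%:R) ->
     {in bs', forall p', exists2 p, p \in bs & p'.2 = q%:R * p.2} ->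
     F <= volume gamma bs') ->
  q%:R `^ (- gamma) * F <=
    \sum_(p <- bs | touch q q' Z V (t * q%:R / q'%:R) p (d, e)) p.2 `^ gamma.
Proof.
move=> q0 q'0 bs0 cov; set t' := t * _ / _ => hF.
have qR : 0 < q%:R :> R by rewrite ltr0n.
have q'R : 0 < q'%:R :> R by rewrite ltr0n.
pose f (p : R * R) : R * R := (q%:R * p.1 - proj t' (d, e), q%:R * p.2).
pose bs' := [seq f p | p <- bs & touch q q' Z V t' p (d, e)].
have h : F <= volume gamma bs'.
  apply: hF => [z v pz pv|_ /mapP[p + ->]]; last first.
    by rewrite mem_filter => /andP[_ pb]; exists p.
  have [p pb hp] := cov _ _ pz.2 pv.2.
  have hp' : `|z + t' * v + proj t' (d, e) - q%:R * p.1| < q%:R * p.2 / 2.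
    rewrite (_ : _ - _ = q%:R * ((d%:R + z) / q%:R + t * ((e%:R + v) / q'%:R) - p.1)).
      by rewrite normrM gtr0_norm// -mulrA ltr_pM2l.
    by rewrite /t' /proj /=; field; rewrite !gt_eqF.
  exists (f p).
    apply/mapP; exists p => //; rewrite mem_filter pb andbT.
    by apply/asboolP; exists z, v.
  by rewrite /f /= opprB addrA.
rewrite powRN mulrC ler_pdivrMr ?powR_gt0//; apply: (le_trans h).
rewrite /volume /bs' big_map big_filter mulr_suml.
rewrite big_seq_cond [leRHS]big_seq_cond; apply: ler_sum => p /andP[/bs0 p0 _].
by rewrite /f /= powRM// ?(ltW qR)// mulrC.
Qed.

End BallCovers.

(** The dichotomy of [rich_or_poor], abstracted so that the contents in base r and in base s are
    measured against one [Q]. *)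
Definition splits (R : realType) (cont : set R -> R) (q : nat) (Q e kappa rho : R)
    (X : set R) : Prop :=
  forall Z x, Z `<=` X -> 0 < x -> x <= cont Z ->
    exists D : seq nat, [/\ uniq D, (0 < size D)%N,
      {in D, forall d, Q `^ (- (5 * e)) * x <= cont (piece q d Z)},
      {subset D <= digits q Z} &
      (exists2 d, d \in D & Q `^ kappa * x <= cont (piece q d Z)) \/
      Q `^ rho <= (size D)%:R].

Section Potential.
Variables (R : realType) (q s M : nat) (b : R) (X Y : set R).
Variables (gamma alpha beta g e e2 A B sg : R).

Let Q : R := q%:R.
Let pen K t : R := penalty (next_slope q s M b)
  (fun u => bad_slope s X Y alpha beta e g b q M (sg * u)) e2 K t.

(* Lower bound for the volume of a ball cover of Z + sg t V when the contents of
   Z and V are at least x and y. *)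
Definition potential K t x y : R := Q `^ (- gamma - B * pen K t) * (x `^ A * y `^ A).

(** Reduces each case of the induction to a linear inequality between exponents of Q. *)
Lemma potential_step c1 c2 u K K' t t' x y : 1 <= Q -> 0 < x -> 0 < y ->
  - B * pen K t <= u + (c1 + c2) * A - B * pen K' t' ->
  potential K t x y <= Q `^ u * potential K' t' (Q `^ c1 * x) (Q `^ c2 * y).
Proof.
move=> Q1 x0 y0 h; have Q0 : 0 < Q by exact: lt_le_trans Q1.
rewrite /potential !powRM ?powR_ge0 ?(ltW x0) ?(ltW y0)// -!powRrM.
rewrite [leRHS](_ : _ = (Q `^ u * Q `^ (- gamma - B * pen K' t') * Q `^ (c1 * A) * Q `^ (c2 * A))
   * (x `^ A * y `^ A)); last by ring.
rewrite -!powRD ?(gt_eqF Q0) ?implybT//.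
rewrite ler_wpM2r ?mulr_ge0 ?powR_ge0// ler_powR//.
by move: h; lra.
Qed.

Lemma potential_le K t x y : 1 <= Q -> 0 <= A -> 0 <= B -> 0 <= x <= 1 -> 0 <= y <= 1 ->
  potential K t x y <= Q `^ (- gamma).
Proof.
move=> Q1 A0 B0 /andP[x0 x1] /andP[y0 y1].
have oneA : 1 `^ A = 1 :> R by rewrite powR1.
have hx : x `^ A <= 1 by rewrite -[leRHS]oneA ge0_ler_powR ?nnegrE.
have hy : y `^ A <= 1 by rewrite -[leRHS]oneA ge0_ler_powR ?nnegrE.
apply: (@le_trans _ _ (Q `^ (- gamma - B * pen K t))).
  by rewrite ler_piMr ?powR_ge0// mulr_ile1 ?powR_ge0.
by rewrite ler_powR// gerBl mulr_ge0// penalty_ge0.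
Qed.

End Potential.

(* Induction on the depth K. At a good slope with both sets rich, the pigeonhole
   gains a power g - gamma - small of Q; a poor set gains Q^(A kappa) through its
   content and a bad slope gains Q^B through the penalty, while all the losses
   are at most Q^(10 e A + B e2). *)
Lemma volume_ge (R : realType) (q s M : nat) (a b : R) (X Y : set R)
    (contX contY : set R -> R) (gamma alpha beta g e e2 kappa A B sg : R) :
  (1 < q)%N -> (1 < s)%N -> 0 < a -> s%:R * a <= b ->
  (s ^ M <= q)%N -> (q < s ^ M.+1)%N -> `|sg| = 1 ->
  (forall d, piece q d X `<=` X) -> (forall n d, piece (s ^ n) d Y `<=` Y) ->
  (forall Z, 0 < contX Z -> Z !=set0) -> (forall Z, 0 < contY Z -> Z !=set0) ->
  (forall d Z, contX (piece q d Z) <= 1) ->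
  (forall n d Z, contY (piece (s ^ n) d Z) <= 1) ->
  splits contX q q%:R e kappa (alpha - 2 * e - kappa) X ->
  (forall n, (M <= n <= M.+1)%N ->
    splits contY (s ^ n) q%:R e kappa (beta - 2 * e - kappa) Y) ->
  0 <= gamma -> 0 <= A -> 0 <= B ->
  gamma + 10 * e * A <= B * (1 - e2) ->
  gamma + 5 * e * A + B * e2 <= A * kappa ->
  gamma + 14 * e + 4 * kappa + 10 * e * A + B * e2 <= g ->
  forall K (Z V : set R) x y t bs, Z `<=` X -> V `<=` Y -> a <= t <= b ->
    0 < x <= 1 -> 0 < y <= 1 -> x <= contX Z -> y <= contY V ->
    ball_cover bs Z V (sg * t) -> {in bs, forall p, q%:R ^- K <= p.2} ->
    potential q s M b X Y gamma alpha beta g e e2 A B sg K (next_slope q s M b t) x y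
      <= volume gamma bs.
Proof.
move=> q1 s1 a0 sab sMlo sMhi sg1 pX pY neX neY oneX oneY spX spY ga0 A0 B0 N1 N2 N3.
have qR1 : 1 <= q%:R :> R by rewrite ler1n ltnW.
have q0 : 0 < q%:R :> R by exact: lt_le_trans qR1.
have qN0 : (0 < q)%N by exact: ltnW.
(* A single ball of diameter at least 1/q already has volume at least q^(-gamma), which bounds every
   potential. *)
have big_ball bs p P : p \in bs -> q%:R^-1 <= p.2 -> P <= q%:R `^ (- gamma) ->
    P <= volume gamma bs.
  move=> pb pq hP; apply: (le_trans hP).
  apply: (@le_trans _ _ (p.2 `^ gamma)).
    rewrite (_ : q%:R `^ (- gamma) = (q%:R^-1) `^ gamma).
      rewrite ge0_ler_powR ?nnegrE ?invr_ge0 ?(ltW q0)//.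
      by rewrite (le_trans _ pq)// invr_ge0 ltW.
    by rewrite -powR_inv1 ?(ltW q0)// -powRrM mulN1r.
  rewrite /volume (big_rem p pb) /= lerDl; apply: sumr_ge0 => p' _; exact: powR_ge0.
elim=> [|K IH] Z V x y t bs ZX VY tW /andP[x0 x1] /andP[y0 y1] xZ yV cov bsK.
  have [z Zz] := neX _ (lt_le_trans x0 xZ); have [v Vv] := neY _ (lt_le_trans y0 yV).
  have [p pb _] := cov z v Zz Vv; apply: (big_ball bs p) => //.
    by apply: le_trans (bsK p pb); rewrite expr0 invr1 invf_le1.
  by apply: potential_le => //; rewrite ?(ltW x0) ?(ltW y0).
have [/hasP[p pb pq]|noball] := boolP (has (fun p => q%:R^-1 < p.2) bs).
  apply: (big_ball bs p) => //; first exact: ltW.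
  by apply: potential_le => //; rewrite ?(ltW x0) ?(ltW y0).
have small : {in bs, forall p, q%:R * p.2 <= 1}.
  move=> p pb; have := hasPn noball p pb; rewrite -leNgt.
  by rewrite -[q%:R^-1]mul1r ler_pdivlMr// mulrC.
set M' := step_exponent q s M b t; pose q' := (s ^ M')%N.
have MM' : (M <= M' <= M.+1)%N.
  by rewrite /M' /step_exponent; case: ifP => _; rewrite ?leqnn ?leqnSn.
have q'0 : (0 < q')%N by rewrite expn_gt0 (ltnW s1).
(* The pieces are projected along the slope after zooming, which is why the potential in the
   conclusion sits at [next_slope] of t. *)
set t1 := next_slope q s M b t.
have t1W : a <= t1 <= b by apply: next_window.
have t1E : sg * t * q%:R / q'%:R = sg * t1 by rewrite /t1 /next_slope !mulrA.
have bs0 : {in bs, forall p, 0 <= p.2}.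
  by move=> p /bsK; apply: le_trans; rewrite invr_ge0 exprn_ge0// ltW.
pose pot K := potential q s M b X Y gamma alpha beta g e e2 A B sg K.
rewrite -/(pot K.+1).
pose tch := touch q q' Z V (sg * t1).
have child d f x' y' : 0 < x' -> 0 < y' -> x' <= contX (piece q d Z) ->
    y' <= contY (piece q' f V) ->
    q%:R `^ (- gamma) * pot K (next_slope q s M b t1) x' y' <=
      \sum_(p <- bs | tch p (d, f)) p.2 `^ gamma.
  move=> x'0 y'0 hx hy; rewrite /tch -t1E; apply: ball_cover_piece => // bs' cov' dia.
  apply: (IH (piece q d Z) (piece q' f V)) => //.
  - by move=> w pw; apply: (pX d); apply: piece_sub ZX _ pw.
  - by move=> w pw; apply: (pY M' f); apply: piece_sub VY _ pw.
  - by rewrite x'0 (le_trans hx).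
  - by rewrite y'0 (le_trans hy)//; apply: oneY.
  - by rewrite -t1E.
  move=> p' /dia[p pb ->]; have := bsK _ pb.
  by rewrite exprS invfM mulrC ler_pdivrMr// mulrC.
have single d f x' y' : 0 < x' -> 0 < y' -> x' <= contX (piece q d Z) ->
    y' <= contY (piece q' f V) ->
    q%:R `^ (- gamma) * pot K (next_slope q s M b t1) x' y' <= volume gamma bs.
  move=> x'0 y'0 hx hy; apply: (le_trans (child d f _ _ x'0 y'0 hx hy)).
  rewrite big_mkcond; apply: ler_sum => p _; case: ifP => // _; exact: powR_ge0.
have [D [uD D0 hD subD DX]] := spX Z x ZX x0 xZ.
have [D' [uD' D'0 hD' subD' DY]] := spY M' MM' V y VY y0 yV.
have Qx c : 0 < q%:R `^ c * x by rewrite mulr_gt0// powR_gt0.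
have Qy c : 0 < q%:R `^ c * y by rewrite mulr_gt0// powR_gt0.
set bad := fun u => bad_slope s X Y alpha beta e g b q M (sg * u).
have pen := penaltyS (next_slope q s M b) bad e2 K t1.
set pen1 := penalty _ _ _ K.+1 t1 in pen.
set pen0 := penalty _ _ _ K _ in pen.
have penB : B * ((bad t1)%:R - e2 + pen0) <= B * pen1 by rewrite ler_wpM2l.
have bad0 : 0 <= B * (bad t1)%:R by rewrite mulr_ge0.
have [d0 d0D] : exists d, d \in D by case: D D0 {uD hD subD DX} => // d *; exists d; rewrite mem_head.
have [f0 f0D] : exists f, f \in D' by case: D' D'0 {uD' hD' subD' DY} => // f *; exists f; rewrite mem_head.
(* Follow the piece of much larger content, with any piece of the other set: the gain [A * kappa]
   pays for the zoom and for one loss of 5eA. *)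
case: DX => [[d dD hd]|richX].
  apply: le_trans (single d f0 _ _ (Qx kappa) (Qy (- (5 * e))) hd (hD' _ f0D)).
  apply: potential_step => //; rewrite -/bad -/pen0 -/pen1; move: penB bad0 N2 {IH child single}.
  clear; lra.
case: DY => [[f fD hf]|richY].
  apply: le_trans (single d0 f _ _ (Qx (- (5 * e))) (Qy kappa) (hD _ d0D) hf).
  apply: potential_step => //; rewrite -/bad -/pen0 -/pen1; move: penB bad0 N2 {IH child single}.
  clear; lra.
(* At a bad slope any pair of pieces will do, since the penalty drops by at least 1 - e2. *)
have [isbad|notbad] := boolP (bad t1).
  apply: le_trans (single d0 f0 _ _ (Qx (- (5 * e))) (Qy (- (5 * e))) (hD _ d0D) (hD' _ f0D)).
  apply: potential_step => //; rewrite -/bad -/pen0 -/pen1; move: penB N1; rewrite isbad.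
  clear; rewrite /=; lra.
(* At a good slope all pairs are used: the square of their number, divided by the energy threshold,
   leaves the exponent g - 14e - 4 kappa. *)
set x' := q%:R `^ (- (5 * e)) * x in hD; set y' := q%:R `^ (- (5 * e)) * y in hD'.
pose P := [seq (d, f) | d <- D, f <- D'].
pose thr := bad_threshold alpha beta e g (q%:R : R).
have thr0 : 0 < thr by exact: powR_gt0.
have uP : uniq P by apply: allpairs_uniq => // -[? ?] [? ?].
have subP : {subset P <= pairs q q' X Y}.
  move=> _ /allpairsP[[d f] /= [dD fD ->]]; apply/allpairsP; exists (d, f) => /=; split=> //.
    by apply: digits_sub ZX _ (subD _ dD).
  by apply: digits_sub VY _ (subD' _ fD).
have Ele : energy P (b + 2) (sg * t1) <= thr.
  apply: le_trans (energy_subset _ _ uP subP) _.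
  move: notbad; rewrite /bad /bad_slope negb_or -!leNgt => /andP[h1 h2].
  by rewrite /q' /M' /step_exponent; case: ifP.
have C0 : 0 <= b + 2.
  by case/andP: t1W => t1a t1b; rewrite addr_ge0// (le_trans _ t1b)// (le_trans _ t1a)// ltW.
have t1n : `|sg * t1| <= b.
  case/andP: t1W => t1a t1b; rewrite normrM sg1 mul1r gtr0_norm//.
  exact: lt_le_trans t1a.
have F0 : 0 <= q%:R `^ (- gamma) * pot K (next_slope q s M b t1) x' y'.
  by rewrite !mulr_ge0 ?powR_ge0.
have := @energy_pigeonhole R _ P bs (fun p => p.2 `^ gamma) tch (b + 2) (sg * t1) thr _
  C0 thr0 F0 Ele (fun p => powR_ge0 _ _).
rewrite -/(volume gamma bs) => pigeon.
have {pigeon} := pigeon ltac:(move=> p pb de de'; apply: touch_near => //; exact: small)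
  ltac:(by move=> _ /allpairsP[[d f] /= [dD fD ->]]; apply: child => //;
    [exact: Qx|exact: Qy|exact: hD|exact: hD']).
rewrite [_ * _ ^+ 2]mulrC -ler_pdivrMl// => pigeon.
apply: le_trans pigeon.
have sizeP : q%:R `^ (alpha - 2 * e - kappa + (beta - 2 * e - kappa)) <= (size P)%:R :> R.
  rewrite /P size_allpairs natrM powRD ?(gt_eqF q0) ?implybT//.
  by rewrite ler_pM ?powR_ge0.
set rho := alpha - _ - _ + _ in sizeP.
have sizeP2 : q%:R `^ (2 * rho) <= (size P)%:R ^+ 2 :> R.
  rewrite mulrC powRrM powR_mulrn ?powR_ge0//.
  by rewrite lerXn2r// nnegrE ?powR_ge0.
apply: (@le_trans _ _ (thr^-1 * (q%:R `^ (2 * rho) * (q%:R `^ (- gamma) *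
    pot K (next_slope q s M b t1) x' y')))); last first.
  by rewrite ler_wpM2l ?invr_ge0 ?(ltW thr0)// ler_wpM2r.
have -> W : thr^-1 * (q%:R `^ (2 * rho) * (q%:R `^ (- gamma) * W)) =
    q%:R `^ (- (2 * (alpha + beta) - g + 6 * e) + 2 * rho - gamma) * W.
  by rewrite /thr /bad_threshold -powRN !powRD ?(gt_eqF q0) ?implybT// !mulrA.
apply: potential_step => //; rewrite -/bad -/pen0 -/pen1; move: penB bad0 N3; rewrite /rho.
clear; lra.
Qed.

(** * Choice of parameters and the uniform bound *)

Lemma exists_small_scale (R : realType) (q : nat) (bs : seq (R * R)) : (1 < q)%N ->
  {in bs, forall p, 0 < p.2} -> exists K, {in bs, forall p, q%:R ^- K <= p.2}.
Proof.
move=> q1; have q1R : 1 <= q%:R :> R by rewrite ler1n ltnW.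
have q0R : 0 < q%:R :> R by exact: lt_le_trans q1R.
elim: bs => [|p bs IH] h; first by exists 0%N.
have [|K hK] := IH; first by move=> p' p'b; apply: h; rewrite inE p'b orbT.
have p0 : 0 < p.2 by apply: h; rewrite mem_head.
have [k hk] := @expn_large R q p.2^-1 q1; rewrite natrX in hk.
exists (maxn K k) => p'; rewrite inE => /orP[/eqP ->|p'b].
  rewrite -[p.2]invrK lef_pV2 ?posrE ?invr_gt0 ?exprn_gt0//.
  by apply: (le_trans hk); rewrite ler_weXn2l// leq_maxr.
apply: le_trans (hK _ p'b); rewrite lef_pV2 ?posrE ?exprn_gt0//.
by rewrite ler_weXn2l// leq_maxl.
Qed.

Lemma parameter_choice (R : realType) (gamma g : R) : 0 < gamma -> gamma < g -> g <= 1 ->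
  exists e kappa A B e2 : R, [/\ [/\ 0 < e, 0 < kappa, 0 <= A, 0 <= B & 0 < e2],
    gamma + 10 * e * A <= B * (1 - e2),
    gamma + 5 * e * A + B * e2 <= A * kappa &
    gamma + 14 * e + 4 * kappa + 10 * e * A + B * e2 <= g].
Proof.
move=> ga0 gag g1; pose h := g - gamma; have h0 : 0 < h by rewrite subr_gt0.
have h1 : h <= 1 by rewrite /h; lra.
have h64 : 0 < h / 64 by rewrite divr_gt0.
(* Then A kappa = 4 = B, while e A = h/64, B e2 = h/8 and 4 kappa = h/4, so all losses stay below
   the gap [h]. *)
exists ((h / 64) ^+ 2), (h / 16), (64 / h), 4, (h / 32).
have eA c : c * (h / 64) ^+ 2 * (64 / h) = c * (h / 64) by field; rewrite gt_eqF.
have Ak : 64 / h * (h / 16) = 4 by field; rewrite gt_eqF.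
have h2 : (h / 64) ^+ 2 <= h / 64 by rewrite expr2 ler_piMr ?(ltW h64)//; lra.
split.
- split; [exact: exprn_gt0|lra|by rewrite divr_ge0 ?(ltW h0)|lra|lra].
- by rewrite eA; lra.
- by rewrite eA Ak; lra.
- by rewrite eA; have : g = gamma + h by [rewrite /h; ring]; lra.
Qed.

(** The depth K of the induction depends on the cover, but the penalty is at most [L] at every
    depth; so the bound depends only on the fixed scale q and on [L], not on the cover or the
    slope. *)
Lemma uniform_volume (R : realType) (r s : nat) (X Y : set R) (alpha beta gamma a b : R) :
  (1 < r)%N -> (1 < s)%N -> piece_closed r X -> piece_closed s Y ->
  irrational (ln r%:R / ln s%:R : R) -> 0 <= alpha -> 0 <= beta ->
  (forall e, 0 < e -> 1 <= content r (alpha - e) X /\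
      exists2 C, 0 < C & forall k,
        (size (digits (r ^ k) X))%:R <= C * (r ^ k)%:R `^ (alpha + e)) ->
  (forall e, 0 < e -> 1 <= content s (beta - e) Y /\
      exists2 C, 0 < C & forall k,
        (size (digits (s ^ k) Y))%:R <= C * (s ^ k)%:R `^ (beta + e)) ->
  0 < gamma -> gamma < alpha + beta -> gamma < 1 -> 0 < a -> s%:R * a <= b ->
  exists2 c0 : R, 0 < c0 & forall sg t bs, `|sg| = 1 -> a <= t <= b ->
    ball_cover bs X Y (sg * t) -> {in bs, forall p, 0 < p.2} ->
    c0 <= volume gamma bs.
Proof.
move=> r1 s1 Xc Yc irr al0 be0 hX hY ga0 gab ga1 a0 sab.
pose g := Num.min (alpha + beta) 1.
have gag : gamma < g by rewrite lt_min gab.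
have g1 : g <= 1 by rewrite ge_min lexx orbT.
have gle : g <= alpha + beta by rewrite ge_min lexx.
have [e [kappa [A [B [e2 [[e0 k0 A0 B0 e20] N1 N2 N3]]]]]] := parameter_choice ga0 gag g1.
have [cX [Cx Cx0 hCx]] := hX _ e0.
have [cY [Cy Cy0 hCy]] := hY _ e0.
have sR1 : 1 <= s%:R :> R by rewrite ler1n ltnW.
have sR0 : 0 < s%:R :> R by exact: lt_le_trans sR1.
have [QX QX1 spX] := rich_or_poor r1 kappa Xc al0 e0 Cx0 (lexx 1) hCx.
have [QY QY1 spY] := rich_or_poor s1 kappa Yc be0 e0 Cy0 sR1 hCy.
have [QB QB1 hbad] := bad_frequency r1 s1 Xc Yc al0 be0 e0 g1 gle Cx0 Cy0 hCx hCy a0 sab irr e20.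
(* One power of r above all thresholds fixes the scale for the whole induction. *)
have [N hN] := @expn_large R r (Num.max 2 (Num.max QX (Num.max QY QB))) r1.
set q := (r ^ N)%N in hN.
have [q2 qX qY qB] : [/\ 2 <= q%:R :> R, QX <= q%:R, QY <= q%:R & QB <= q%:R].
  by move: hN; rewrite !ge_max => /and4P[].
have q1 : (1 < q)%N by rewrite -(ler_nat R).
have q0 : 0 < q%:R :> R by exact: lt_le_trans q2.
pose M := trunc_log s q.
have sMlo : (s ^ M <= q)%N by rewrite trunc_logP// ltnW.
have sMhi : (q < s ^ M.+1)%N by rewrite trunc_log_ltn.
have [L [L0 hL]] := hbad _ _ qB sMlo sMhi.
exists (q%:R `^ (- gamma - B * L%:R)); first exact: powR_gt0.
move=> sg t bs sg1 tW cov bs0.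
have [K hK] := exists_small_scale q1 bs0.
have oneX d Z : content r (alpha - e) (piece q d Z) <= 1 by exact: content_piece_le1.
have oneY n d Z : content s (beta - e) (piece (s ^ n) d Z) <= 1 by exact: content_piece_le1.
have := @volume_ge R q s M a b X Y (content r (alpha - e)) (content s (beta - e))
  gamma alpha beta g e e2 kappa A B sg q1 s1 a0 sab sMlo sMhi sg1 (Xc.2 N) Yc.2
  (fun Z hZ => content_gt0_neq0 hZ) (fun Z hZ => content_gt0_neq0 hZ) oneX oneY.
rewrite -/q => H.
have pen_le : penalty (next_slope q s M b) (fun u => bad_slope s X Y alpha beta e g b q M (sg * u))
    e2 K (next_slope q s M b t) <= L%:R.
  apply: (@penalty_le _ _ _ _ [set u | a <= u <= b]) => //=.
  - exact: ltW.
  - by move=> u uW; apply: next_window.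
  - by move=> u uW; exact: hL.
  - by apply: next_window.
apply: le_trans (H _ _ (ltW ga0) A0 B0 N1 N2 N3 K X Y 1 1 t bs _ _ tW _ _ cX cY cov hK) => //.
- by rewrite /potential !powR1 !mulr1 ler_powR ?ler1n ?(ltnW q1)// lerD2l lerN2 ler_wpM2l.
- move=> Z x ZX x0 xZ; apply: spX => //.
  by rewrite divr1 mul1r lexx.
- move=> n /andP[Mn nM] Z x ZX x0 xZ; apply: spY => //.
  rewrite ler_pdivrMr// -!natrM !ler_nat; apply/andP; split.
    by rewrite (leq_trans (ltnW sMhi))// expnSr leq_mul// leq_exp2l.
  by rewrite (leq_trans (_ : _ <= s ^ M.+1)%N) ?leq_exp2l// expnS leq_mul.
- by rewrite ltr01 lexx.
- by rewrite ltr01 lexx.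
Qed.

(** * Reduction to finite covers and a compact range of slopes *)

Lemma scaled_sumset_compact (R : realType) (la et : R) (X Y : set R) :
  compact X -> compact Y -> compact (scaled_sumset la et X Y).
Proof.
move=> cX cY.
have -> : scaled_sumset la et X Y = [set la * p.1 + et * p.2 | p in X `*` Y].
  apply/seteqP; split => [_ [x Xx [y Yy <-]]|_ [[x y] [/= Xx Yy] <-]].
    by exists (x, y).
  by exists x => //; exists y.
apply: continuous_compact; last exact: compact_setX.
apply: continuous_subspaceT => p.
apply: cvgD; apply: cvgM; [exact: cvg_cst|exact: cvg_fst|exact: cvg_cst|exact: cvg_snd].
Qed.

Lemma compact_away0 (R : realType) (I : set R) : compact I -> I `<=` ~` [set 0] ->
  exists m M : R, [/\ 0 < m, m <= M & forall x, I x -> m <= `|x| <= M].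
Proof.
move=> cI I0.
have [M hM] : exists M : R, forall x, I x -> `|x| <= M.
  have [M [_ hM]] := compact_bounded cI; exists (M + 1) => x Ix.
  by apply: (hM (M + 1)) => //; rewrite ltrDl.
have nI : nbhs (0 : R) (~` I).
  apply: open_nbhs_nbhs; split; last by move=> /I0 /(_ erefl).
  exact: closed_openC (compact_closed (@norm_hausdorff _ _) cI).
have /nbhs_ballP[m /= m0 hm] := nI.
exists m, (Num.max m M); split => // [|x Ix]; first by rewrite le_max lexx.
rewrite le_max hM// orbT andbT leNgt; apply/negP => xm.
by apply: (hm x) => //; rewrite /ball /= sub0r normrN.
Qed.

Lemma mult_independent_gt1 (R : realType) (r s : nat) : (0 < r)%N -> (0 < s)%N ->
  mult_independent R r s -> (1 < r)%N /\ (1 < s)%N.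
Proof.
move=> r0 s0 irr; have irr0 : ln r%:R / ln s%:R != 0 :> R.
  by apply/eqP => h; apply: irr; rewrite h; exists 0; rewrite ?rmorph0.
split; rewrite ltn_neqAle eq_sym ?r0 ?s0 andbT; apply/eqP => E; move: irr0.
  by rewrite E ln1 mul0r eqxx.
by rewrite E ln1 invr0 mulr0 eqxx.
Qed.

Theorem theoremA (R : realType) (r s : nat) (hr : (0 < r)%N) (hs : (0 < s)%N)
  (hrs : mult_independent R r s)
  (X Y : set R) (hX0 : X !=set0) (hY0 : Y !=set0)
  (hX : times_invariant r X) (hY : times_invariant s Y)
  (I : set R) (hI : compact I) (hI0 : I `<=` ~` [set 0])
  (gamma : R) (hgamma0 : 0 < gamma)
  (hgamma : (gamma%:E < mine (hausdorff_dim X + hausdorff_dim Y) 1)%E) :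
  (0 < ereal_inf [set hausdorff_content gamma (scaled_sumset lambda eta X Y) |
                    lambda in I & eta in I])%E.
Proof.
have [r1 s1] := mult_independent_gt1 hr hs hrs.
have Xc := times_invariant_piece hr hX; have Yc := times_invariant_piece hs hY.
have [al [al0 dX critX]] := critical_exponent r1 Xc hX0.
have [be [be0 dY critY]] := critical_exponent s1 Yc hY0.
have [gab ga1] : gamma < al + be /\ gamma < 1.
  move: hgamma; rewrite lt_min lte_fin => /andP[h ->]; split => //.
  by have := lt_le_trans h (leeD dX dY); rewrite -EFinD lte_fin.
have [m [M [m0 mM hm]]] := compact_away0 hI hI0.
have M0 : 0 < M by exact: lt_le_trans mM.
have s1R : 1 <= s%:R :> R by rewrite ler1n ltnW.
(* Dividing by [la] leaves the slope [et / la], of modulus between m/M and M/m; the factor s widens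
   the window as the orbit of slopes requires. *)
pose a := m / M; pose b := s%:R * (M / m).
have a0 : 0 < a by rewrite divr_gt0.
have a1 : a <= 1 by rewrite ler_pdivrMr// mul1r.
have b1 : 1 <= M / m by rewrite ler_pdivlMr// mul1r.
have sab : s%:R * a <= b.
  by rewrite ler_wpM2l//; apply: le_trans b1.
have [c0 c00 hc0] := uniform_volume r1 s1 Xc Yc hrs al0 be0 critX critY hgamma0 gab ga1 a0 sab.
have compX (Z : set R) : Z `<=` `[0, 1] -> closed Z -> compact Z.
  by move=> Z01 cZ; apply: subclosed_compact cZ (@segment_compact _ 0 1) Z01.
have [compactX compactY] : compact X /\ compact Y.
  by case: hX => X01 cX _; case: hY => Y01 cY _; split; exact: compX.
(* Undoing the division multiplies diameters by [|la|], which is at least [m]. *)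
apply: (@lt_le_trans _ _ (m `^ gamma * c0)%:E).
  by rewrite lte_fin mulr_gt0// powR_gt0.
apply: le_ereal_inf_tmp => _ [la Ila [et Iet <-]].
apply: le_ereal_inf_tmp => _ [D [c [delta [delta0 cover_sum ->]]]].
have /andP[mla laM] := hm _ Ila; have /andP[met etM] := hm _ Iet.
have la0 : 0 < `|la| by exact: lt_le_trans mla.
have et0 : 0 < `|et| by exact: lt_le_trans met.
have lan0 : la != 0 by rewrite -normr_gt0.
(* Compactness gives a finite subcover, whose volume is at most the sum over the whole cover. *)
have := @scaled_sumset_compact R la et X Y compactX compactY.
rewrite compact_cover => /(_ nat D (fun i => ball (c i) (delta i / 2))).
case=> [i _|//|D' subD cov]; first exact: ball_open.
pose bs := [seq (c i / la, delta i / `|la|) | i <- finmap.enum_fset D'].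
pose t := `|et / la|; pose sg := Num.sg (et / la).
have sgt : sg * t = et / la by rewrite /sg /t -numEsg.
have tW : a <= t <= b.
  rewrite /t normrM normfV; apply/andP; split.
    by rewrite ler_pM ?invr_ge0 ?(ltW m0) ?(ltW M0)// lef_pV2.
  apply: (@le_trans _ _ (M / m)); last by rewrite ler_peMl// divr_ge0 ?(ltW m0) ?(ltW M0).
  by rewrite ler_pM ?invr_ge0 ?(ltW et0) ?(ltW la0)// lef_pV2.
have sg1 : `|sg| = 1.
  have etn0 : et != 0 by rewrite -normr_gt0.
  by rewrite /sg normr_sg mulf_neq0 ?invr_neq0.
have D'D i : i \in finmap.enum_fset D' -> D i by move=> /subD; rewrite inE.
have bcov : ball_cover bs X Y (sg * t).
  move=> x y Xx Yy.
  have [|i iD' hi] := cov (la * x + et * y); first by exists x => //; exists y.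
  exists (c i / la, delta i / `|la|); first by apply/mapP; exists i.
  rewrite /= sgt (_ : _ - _ = - (c i - (la * x + et * y)) / la); last by field.
  by rewrite normrM normfV normrN [ltRHS]mulrAC ltr_pM2r ?invr_gt0.
have bs0 : {in bs, forall p, 0 < p.2}.
  by move=> _ /mapP[i iD' ->] /=; rewrite divr_gt0//; apply: delta0; exact: D'D.
have := hc0 sg t bs sg1 tW bcov bs0.
rewrite /volume /bs big_map /= => hvol.
apply: esum_ge; exists [set` finmap.enum_fset D'].
  by split; [exact: finite_seq|move=> i /= /D'D].
rewrite -(fsbig_seq _ _ (finmap.fset_uniq D')) sumEFin lee_fin.
apply: (@le_trans _ _ (`|la| `^ gamma * c0)).
  rewrite ler_pM2r// ge0_ler_powR ?nnegrE ?(ltW m0) ?(ltW hgamma0) ?(ltW la0)//.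
rewrite -ler_pdivlMl ?powR_gt0//; apply: (le_trans hvol).
rewrite mulr_sumr big_seq [leRHS]big_seq; apply: ler_sum => i iD'.
have di : 0 < delta i by apply: delta0; exact: D'D.
rewrite powRM ?invr_ge0 ?(ltW di)// mulrC -(powR_inv1 (ltW la0)) -powRrM mulN1r powRN.
by [].
Qed.
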